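(* Let $X$ be a Banach function space (B.f.s.), let $(\Omega,\Sigma)$ be a measurable space and let $m\colon\Sigma\to X$ be a $\sigma$-additive vector measure. Assume: (a) $X$ and its dual $X^*$ have the subsequence splitting property. (b) The range $m(\Sigma)=\{m(A):A\in\Sigma\}$ of $m$ has uniformly absolutely continuous norm in $X$. Then the B.f.s. $L^1(m)$ has the subsequence splitting property.
   Context: All functions are real-valued. A Banach function space (B.f.s.) $X$ over a measure space $(S,\mathcal{S},\rho)$ is a Banach space of classes of measurable functions on $S$ satisfying the ideal property: $g\in X$ and $\|g\|_X\le\|f\|_X$ whenever $f\in X$ and $|g|\le|f|$ $\rho$-a.e. $X$ has absolutely continuous (a.c.) norm if $\lim_{\rho(A)\to0}\|f\chi_A\|_X=0$ for every $f\in X$, where $\chi_A$ is the characteristic function of $A\in\mathcal{S}$. A subset $K\subseteq X$ has uniformly a.c. norm if $\lim_{\rho(A)\to0}\sup_{f\in K}\|f\chi_A\|_X=0$. Subsequence splitting property: a B.f.s. $X$ with a.c. norm over a measure space has this property if for every norm bounded sequence $\{f_n\}\subseteq X$ there are a subsequence $\{f'_n\}$ of $\{f_n\}$ and sequences $\{g_n\}$ and $\{h_n\}$ in $X$ such that: (a) for each $n\in\mathbb{N}$, $f'_n=g_n+h_n$ with $g_n$ and $h_n$ having disjoint support; (b) the sequence $\{g_n\}$ has uniformly a.c. norm in $X$; (c) the functions $\{h_n\}$ have pairwise disjoint support. (In particular, having this property includes having a.c. norm.) $X^*$ is the dual Banach space of $X$, regarded as a B.f.s. by identifying it with the associate space of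 $X$, that is, the space of all measurable functions $g$ satisfying $fg\in L^1(\rho)$ for all $f\in X$, acting by $f\mapsto\int_S fg\,d\rho$. The space $L^1(m)$: for $x^*\in X^*$ let $x^*m$ be the scalar measure $A\mapsto\langle x^*,m(A)\rangle$ and $|x^*m|$ its variation measure. The semivariation of $m$ is $\|m\|(A):=\sup\{|x^*m|(A):x^*\in B_{X^*}\}$, where $B_{X^*}$ is the closed unit ball of $X^*$. A measurable $f\colon\Omega\to\mathbb{R}$ is $m$-integrable if $f\in L^1(|x^*m|)$ for every $x^*\in X^*$ and, for each $A\in\Sigma$, there exists a vector $\int_A f\,dm\in X$ with $\langle\int_A f\,dm,x^*\rangle=\int_A f\,dx^*m$ for every $x^*\in X^*$. $L^1(m)$ is the space of $m$-integrable functions, identified when they agree $\|m\|$-a.e., with norm $\|f\|_{L^1(m)}:=\sup\{\int_\Omega|f|\,d|x^*m|:x^*\in B_{X^*}\}$. A Rybakov control measure for $m$ is a measure of the form $\eta=|x_0^*m|$ for a suitable $x_0^*\in X^*$ such that $\eta(A)=0$ if and only if $\|m\|(A)=0$; $L^1(m)$ is a B.f.s. over $(\Omega,\Sigma,\eta)$ relative to any Rybakov control measure $\eta$ for $m$.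
   Formalization: The measure ρ underlying the B.f.s. X is assumed finite; for infinite ρ the claim fails with these definitions, e.g. X = c_0 over counting measure on N with m(A) = the sum over i in A of 2^{-i} e_i. *)

(* Defs.v *)
From HB Require Import structures.
From mathcomp Require Import all_boot all_order all_algebra.
From mathcomp Require Import all_classical all_reals all_analysis.

Set Implicit Arguments.
Unset Strict Implicit.
Unset Printing Implicit Defensive.

Import Order.TTheory GRing.Theory Num.Theory.
Import numFieldNormedType.Exports.

Local Open Scope classical_set_scope.
Local Open Scope ring_scope.

(* A space of classes of measurable functions is handled through the
   representatives of its classes: [fs_norm f] is the norm of the class of [f],
   meaningful when [fs_mem f] holds. Working with values in [\bar R] avoids the
   default value of real suprema. *)
Record fspace (T : Type) (R : realType) := FSpace {
  fs_mem : set (T -> R);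
  fs_norm : (T -> R) -> \bar R }.

Section subsequence_splitting.
Context d (T : measurableType d) (R : realType).
Variables (mu : {measure set T -> \bar R}) (E : fspace T R).

Definition unif_ac (K : set (T -> R)) : Prop :=
  forall e : R, 0 < e -> exists2 dlt : R, 0 < dlt &
    forall A, measurable A -> (mu A < dlt%:E)%E ->
      (ereal_sup [set fs_norm E (f \* \1_A)%R | f in K] < e%:E)%E.

Definition ac_norm : Prop :=
  forall f, fs_mem E f ->
  forall e : R, 0 < e -> exists2 dlt : R, 0 < dlt &
    forall A, measurable A -> (mu A < dlt%:E)%E ->
      (fs_norm E (f \* \1_A)%R < e%:E)%E.

Definition norm_bounded (f : (T -> R)^nat) : Prop :=
  exists M : R, forall n, (fs_norm E (f n) <= M%:E)%E.

(* Supports of classes are defined up to null sets. *)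
Definition disjoint_supp (f g : T -> R) : Prop :=
  {ae mu, forall x, f x = 0 \/ g x = 0}.

Definition ssp : Prop := ac_norm /\
  forall f : (T -> R)^nat, (forall n, fs_mem E (f n)) -> norm_bounded f ->
  exists (s : nat -> nat) (g h : (T -> R)^nat),
    [/\ {homo s : i j / (i < j)%N},
        forall n, fs_mem E (g n) /\ fs_mem E (h n),
        forall n, f (s n) = g n \+ h n %[ae mu] /\ disjoint_supp (g n) (h n),
        unif_ac (range g) &
        forall i j, i != j -> disjoint_supp (h i) (h j)].

End subsequence_splitting.

(* A Banach function space over [mu] is a Banach space [X] with an injective
   linear map into the classes of measurable functions, given here by
   [bfs_fun], which selects a representative in each class, with the ideal
   property. *)
Record bfs d (T : measurableType d) (R : realType)
    (mu : {measure set T -> \bar R}) (X : completeNormedModType R) := Bfs {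
  bfs_fun :> X -> T -> R;
  bfs_measurable : forall x, measurable_fun [set: T] (bfs_fun x);
  bfs_linear : forall (a : R) x y,
    bfs_fun (a *: x + y) = (fun t => a * bfs_fun x t + bfs_fun y t) %[ae mu];
  bfs_inj : forall x y, bfs_fun x = bfs_fun y %[ae mu] -> x = y;
  bfs_ideal : forall x (g : T -> R), measurable_fun [set: T] g ->
    {ae mu, forall t, `|g t| <= `|bfs_fun x t|} ->
    exists2 y, bfs_fun y = g %[ae mu] & `|y| <= `|x| }.

Section bfs_spaces.
Context d (T : measurableType d) (R : realType).
Variables (mu : {measure set T -> \bar R}) (X : completeNormedModType R).
Variable B : bfs mu X.

(* By [bfs_inj], the infimum is over a single value when [fs_mem f] holds. *)
Definition bfs_fspace : fspace T R := FSpace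
  [set f | measurable_fun [set: T] f /\ exists x, B x = f %[ae mu]]
  (fun f => ereal_inf [set `|x|%:E | x in [set x | B x = f %[ae mu]]]).

(* The model of the dual as a function space over [mu]: [g] acts on [X] by
   [x |-> \int[mu]_t (B x t * g t)], and its norm is the dual norm of this
   functional. If some non-null set carries no element of [X], this norm does
   not see the values of [g] there. *)
Definition associate : fspace T R := FSpace
  [set g | measurable_fun [set: T] g /\
           forall x, mu.-integrable [set: T] (fun t => (B x t * g t)%:E)]
  (fun g => ereal_sup
     [set `|\int[mu]_t (B x t * g t)%:E|%E | x in [set x | `|x| <= 1]]).

End bfs_spaces.

Record banach_dual (R : realType) (X : completeNormedModType R) := Dual {
  dual_fun :> {linear X -> R^o};
  dual_continuous : continuous dual_fun }.

Definition dual_norm (R : realType) (X : completeNormedModType R)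
    (phi : banach_dual X) : \bar R :=
  ereal_sup [set `|phi x|%:E | x in [set x | `|x| <= 1]].

Definition dual_ball (R : realType) (X : completeNormedModType R) :
  set (banach_dual X) := [set phi | (dual_norm phi <= 1)%E].

Record vector_measure d (T : measurableType d) (R : realType)
    (X : completeNormedModType R) := VectorMeasure {
  vm_fun :> set T -> X;
  vm_sigma_additive : forall F : (set T)^nat,
    (forall i, measurable (F i)) -> trivIset [set: nat] F ->
    (fun n => \sum_(0 <= i < n) vm_fun (F i)) @ \oo
      --> vm_fun (\bigcup_n F n) }.

(* The scalar measures [phi \o m] are charges, so that the library's Hahn and
   Jordan decompositions and variation apply to them. *)
Section scalar_measure.
Context d (T : measurableType d) (R : realType).
Variables (X : completeNormedModType R).
Variables (m : vector_measure T X) (phi : banach_dual X).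

Definition scalar_fun (A : set T) : \bar R := (phi (m A) : R)%:E.

Lemma vector_measure0 : m set0 = 0.
Proof.
have := @vm_sigma_additive _ _ _ _ m (fun=> set0) (fun=> measurable0)
  (@trivIset_set0 _ _ _).
rewrite bigcup0// => cv.
have cS : (fun n => \sum_(0 <= i < n.+1) m set0) @ \oo --> m set0.
  by move: cv; rewrite -(cvg_shiftS).
have : (fun n => (\sum_(0 <= i < n.+1) m set0) - \sum_(0 <= i < n) m set0)
    @ \oo --> m set0 - m set0 by exact: cvgB.
under eq_fun do rewrite big_nat_recr//= addrAC subrr add0r.
by rewrite subrr => /(cvg_unique _ (@cvg_cst _ _ _ _ _)); apply.
Qed.

Let scalar_fun0 : scalar_fun set0 = 0%E.
Proof. by rewrite /scalar_fun vector_measure0 linear0. Qed.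

Let scalar_fun_fin A : measurable A -> scalar_fun A \is a fin_num.
Proof. by []. Qed.

Let scalar_fun_sigma_additive : semi_sigma_additive scalar_fun.
Proof.
move=> F mF tF _; rewrite /scalar_fun.
under eq_fun do rewrite sumEFin -(linear_sum phi).
apply: cvg_EFin; first exact: nearW.
exact: cvg_comp _ _ (vm_sigma_additive mF tF) (@dual_continuous _ _ phi _).
Qed.

HB.instance Definition _ := isCharge.Build _ _ _ scalar_fun
  scalar_fun0 scalar_fun_fin scalar_fun_sigma_additive.

End scalar_measure.

Section L1.
Context d (T : measurableType d) (R : realType).
Variables (X : completeNormedModType R) (m : vector_measure T X).

Definition hahn_pos (phi : banach_dual X) : set T :=
  sval (cid (Hahn_decomposition (scalar_fun m phi))).

Definition hahn_neg (phi : banach_dual X) : set T :=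
  sval (cid (svalP (cid (Hahn_decomposition (scalar_fun m phi))))).

Definition hahn_scalar (phi : banach_dual X) :
    hahn_decomposition (scalar_fun m phi) (hahn_pos phi) (hahn_neg phi) :=
  svalP (cid (svalP (cid (Hahn_decomposition (scalar_fun m phi))))).

Definition scalar_variation (phi : banach_dual X) : {measure set T -> \bar R} :=
  charge_variation (hahn_scalar phi).

(* Integral of [f] over [A] against the signed measure [phi \o m], through its
   Jordan decomposition. *)
Definition scalar_integral (phi : banach_dual X) (A : set T) (f : T -> R) : \bar R :=
  (\int[jordan_pos (hahn_scalar phi)]_(t in A) (f t)%:E -
   \int[jordan_neg (hahn_scalar phi)]_(t in A) (f t)%:E)%E.

Definition semivariation (A : set T) : \bar R :=
  ereal_sup [set scalar_variation phi A | phi in @dual_ball R X].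

Definition vm_integrable (f : T -> R) : Prop :=
  [/\ measurable_fun [set: T] f,
      forall phi : banach_dual X, (scalar_variation phi).-integrable [set: T] (EFin \o f) &
      forall A, measurable A ->
        exists v : X, forall phi : banach_dual X,
          (phi v : R)%:E = scalar_integral phi A f].

Definition L1 : fspace T R := FSpace
  [set f | vm_integrable f]
  (fun f => ereal_sup
     [set \int[scalar_variation phi]_t `|f t|%:E | phi in @dual_ball R X]%E).

Definition rybakov (phi : banach_dual X) : Prop :=
  forall A, measurable A -> scalar_variation phi A = 0%E <-> semivariation A = 0%E.

End L1.

(* Main.v *)
Require Import Defs.
From HB Require Import structures.
From mathcomp Require Import all_boot all_order all_algebra.
From mathcomp Require Import all_classical all_reals all_analysis.
From mathcomp Require Import measurable_realfun ring lra.
Import Order.TTheory GRing.Theory Num.Theory.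
Import numFieldNormedType.Exports.
Set Implicit Arguments.
Unset Strict Implicit.
Unset Printing Implicit Defensive.
Local Open Scope classical_set_scope.
Local Open Scope ring_scope.

(** Write [I_f A] for the integral of [f] over [A] with respect to [m], a vector
    of [X]. The norm of [f \* \1_A] in L^1(m) lies between the supremum of
    [`|I_f D|] over the measurable [D] contained in [A] and four times this
    supremum, so everything about L^1(m) is read off from the vectors [I_f D].

    The heart of the proof is [ssp_no_c0_array]: a space [X] with the
    subsequence splitting property contains no triangular array [u N i]
    ([i < N]) whose rows have uniformly bounded signed sums, whose entries have
    norm at least [e], and whose columns have uniformly absolutely continuous
    norm. Indeed the average [v N] of the absolute values of the signed sums of
    row [N] is a bounded sequence of [X], and by Khintchine's inequality it
    dominates the square function of the row. Split a subsequence of [v] as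
    [g + h], with [g] of uniformly absolutely continuous norm and the [h]
    disjoint. On the support of [h N], which is small for suitable [N], the
    entries of the first columns are negligible. Off this support the square
    function is controlled by [g N], hence only boundedly many entries can
    exceed a fixed fraction of [g N] at a given point; some entry does so only
    on a small set, where [g N] has small norm. That entry has small norm.

    This lemma is used twice. If [f] is in L^1(m) and its norm is not absolutely
    continuous with respect to a Rybakov measure, then a gliding hump gives
    disjoint sets [D i] with [`|I_f (D i)|] bounded below, and the array with
    constant columns [I_f (D i)] is forbidden ([vm_int_ac]). For a bounded
    sequence [f n], suppose that the parts of [f n] between two levels do not
    become uniformly small when the lower level grows. Then one finds levels
    [l 0 < l 1 < l 2 < ...] and, for every [N], an index [n] such that each of
    the [N] parts of [f n] between consecutive levels has an integral of norm at
    least [e]. These integrals form a forbidden array: each column comes from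
    functions with a common bound, so its absolute continuity follows from that
    of the range of [m] ([no_uniform_bands]).

    Hence truncating [f n] at levels that grow along a subsequence leaves
    functions of uniformly absolutely continuous norm. The parts above these
    levels live on sets of small measure, and along a sparse subsequence
    removing from each of these sets the union of the later ones makes them
    disjoint and moves only functions of small norm
    ([good_subsequence], [splitting_of_subsequence]).

    Two facts of functional analysis enter: norming functionals, to bound a
    vector through its scalar integrals, and the uniform boundedness principle
    for weakly bounded sets, to bound [I_f D] over all [D]. *)

(** * Averages over signs and Khintchine's inequality *)

Section sign_average.
Context {R : realType}.

(** The average of [phi (x + \sum_(i < n) s i *: a i)] over all choices of signs
    [s]. Averaging one sign at a time makes norm bounds and pointwise evaluation
    immediate inductions. *)
Fixpoint sign_avg {V : lmodType R} (phi : V -> V) (a : nat -> V) n x : V :=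
  if n is k.+1 then
    2^-1 *: (sign_avg phi a k (x + a k) + sign_avg phi a k (x - a k))
  else phi x.

Lemma sign_avg_le (V : lmodType R) (N : V -> R) (phi : V -> V) (a : nat -> V) n C :
  (forall x y, N (x + y) <= N x + N y) ->
  (forall k x, 0 <= k -> N (k *: x) = k * N x) ->
  forall x,
  (forall s : nat -> bool, N (phi (x + \sum_(i < n) (-1) ^+ s i *: a i)) <= C) ->
  N (sign_avg phi a n x) <= C.
Proof.
move=> ND NZ; elim: n => [|n IH] x H /=.
  by have := H (fun=> false); rewrite big_ord0 addr0.
rewrite NZ ?invr_ge0// ler_pdivrMl//.
have step (b : bool) : N (sign_avg phi a n (x + (-1) ^+ b *: a n)) <= C.
  apply: IH => s; have := H (fun i => if i == n then b else s i).
  rewrite big_ord_recr/= eqxx.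
  under eq_bigr do rewrite ltn_eqF//.
  by rewrite (addrC (\sum_(_ < _) _)) addrA.
apply: le_trans (ND _ _) _.
have := step false; have := step true.
rewrite expr0 expr1 scale1r scaleN1r; lra.
Qed.

End sign_average.

Local Notation abs_avg a n x := (@sign_avg _ _^o (fun y => `|y|) a n x).

Section khintchine.
Context {R : realType}.

(** Pointwise [t * y ^+ 2 - 4 / 27 * t ^+ 3 * y ^+ 4 <= `|y|]; averaging this for
    [y = x + \sum_i s i * a i] only involves the second and fourth moments of a
    signed sum. The fourth moment, bounded by
    [x ^+ 4 + 6 * x ^+ 2 * s + 3 * s ^+ 2], is what the induction on [n] tracks. *)
Lemma abs_avg_ge (a : nat -> R) n x t : 0 <= t ->
  let s := \sum_(i < n) a i ^+ 2 in
  t * (x ^+ 2 + s) - 4 / 27 * t ^+ 3 *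
     (x ^+ 4 + 6 * x ^+ 2 * s + 3 * s ^+ 2) <= abs_avg a n x.
Proof.
move=> t0; elim: n x => [|n IH] x /=.
  rewrite big_ord0 mulr0 expr0n/= mulr0 !addr0.
  rewrite -(real_normK (num_real x)) -[x ^+ 4]/(x ^+ (2 * 2)) exprM.
  rewrite -(real_normK (num_real x)).
  have := normr_ge0 x; set y := `|x| => y0.
  have ty0 : 0 <= t * y by rewrite mulr_ge0.
  suff : t * y - 4 / 27 * (t * y) ^+ 3 <= 1.
    move=> h; rewrite -[leRHS]mulr1 (le_trans _ (ler_wpM2l y0 h))//.
    by rewrite le_eqVlt; apply/orP; left; apply/eqP; ring.
  move: (t * y) ty0 => z z0.
  (* [z - 4 / 27 * z ^+ 3] is maximal on the half-line at [3 / 2], with value 1. *)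
  have -> : z - 4 / 27 * z ^+ 3 =
      1 - 4 / 27 * (z - 3 / 2) ^+ 2 * (z + 3) by field.
  by rewrite gerBl mulr_ge0 ?addr_ge0// mulr_ge0 ?sqr_ge0// divr_ge0.
have := IH (x + a n); have := IH (x - a n).
rewrite big_ord_recr/=; set s := \sum_(i < n) _.
have s0 : 0 <= s by apply: sumr_ge0 => i _; exact: sqr_ge0.
set u := sign_avg _ _ _ _; set v := sign_avg _ _ _ _.
move=> h1 h2; rewrite /GRing.scale/=.
have t3 : 0 <= t ^+ 3 * a n ^+ 4.
  apply: mulr_ge0; first exact: exprn_ge0.
  by rewrite (_ : a n ^+ 4 = (a n ^+ 2) ^+ 2) ?sqr_ge0// -exprM.
have e : t * ((x - a n) ^+ 2 + s) - 4 / 27 * t ^+ 3 *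
       ((x - a n) ^+ 4 + 6 * (x - a n) ^+ 2 * s + 3 * s ^+ 2) +
   (t * ((x + a n) ^+ 2 + s) - 4 / 27 * t ^+ 3 *
     ((x + a n) ^+ 4 + 6 * (x + a n) ^+ 2 * s + 3 * s ^+ 2)) =
  2 * (t * (x ^+ 2 + (s + a n ^+ 2)) - 4 / 27 * t ^+ 3 *
     (x ^+ 4 + 6 * x ^+ 2 * (s + a n ^+ 2) + 3 * (s + a n ^+ 2) ^+ 2))
  + 16 / 27 * (t ^+ 3 * a n ^+ 4) by field.
have := lerD h1 h2; rewrite e => h3.
rewrite ler_pdivlMl// (le_trans _ (le_trans h3 _))//; last by rewrite addrC.
by rewrite lerDl mulr_ge0.
Qed.

(** Khintchine's inequality in L^1, from [abs_avg_ge] at [x = 0] with [t] the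
    inverse of the square root of the sum of squares; this yields the constant
    [81 / 25], rounded up to [4]. *)
Lemma khintchine (a : nat -> R) n :
  \sum_(i < n) a i ^+ 2 <= 4 * abs_avg a n 0 ^+ 2.
Proof.
set s := \sum_(i < n) _.
have s0 : 0 <= s by apply: sumr_ge0 => i _; exact: sqr_ge0.
have [->|sn0] := eqVneq s 0; first by rewrite mulr_ge0 ?sqr_ge0.
have sp : 0 < Num.sqrt s by rewrite sqrtr_gt0 lt0r sn0.
have := @abs_avg_ge a n 0 (Num.sqrt s)^-1 (ltW (eqbRL (invr_gt0 _) sp)).
have es : s = Num.sqrt s ^+ 2 by rewrite sqr_sqrtr.
rewrite /= -/s; move: (Num.sqrt s) sp es => r r0 ->.
rewrite (_ : _ - _ = 5 / 9 * r); last by field; rewrite gt_eqF.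
set k := sign_avg _ _ _ _ => h.
have : (5 / 9 * r) ^+ 2 <= k ^+ 2.
  by rewrite ler_sqr ?nnegrE// ?(le_trans _ h)// mulr_ge0// ltW//; lra.
have : 0 <= r ^+ 2 by exact: sqr_ge0.
rewrite exprMn; lra.
Qed.

End khintchine.

(** * Lattice operations in a Banach function space *)

Section bfs_theory.
Context d (S : measurableType d) (R : realType).
Variables (rho : {measure set S -> \bar R}) (X : completeNormedModType R).
Variable B : bfs rho X.

Lemma bfs_lin (a : R) x y : \forall t \ae rho, B (a *: x + y) t = a * B x t + B y t.
Proof. by have := bfs_linear B a x y; apply: filterS => t; exact. Qed.

Lemma bfs_ae0 : \forall t \ae rho, B 0 t = 0.
Proof.
have := bfs_lin (-1) 0 0; rewrite scaler0 addr0; apply: filterS => t ->.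
by rewrite mulN1r addNr.
Qed.

Lemma bfs_aeD x y : \forall t \ae rho, B (x + y) t = B x t + B y t.
Proof.
by have := bfs_lin 1 x y; rewrite scale1r; apply: filterS => t ->; rewrite mul1r.
Qed.

Lemma bfs_aeZ a x : \forall t \ae rho, B (a *: x) t = a * B x t.
Proof.
have := bfs_lin a x 0; rewrite addr0.
by apply: filterS2 bfs_ae0 => t -> ->; rewrite addr0.
Qed.

Lemma bfs_aeB x y : \forall t \ae rho, B (x - y) t = B x t - B y t.
Proof.
have := bfs_lin (-1) y x; rewrite scaleN1r addrC.
by apply: filterS => t ->; rewrite mulN1r addrC.
Qed.

Lemma bfs_ae_inj x y : (\forall t \ae rho, B x t = B y t) -> x = y.
Proof. by move=> h; apply: (@bfs_inj _ _ _ _ _ B); apply: filterS h. Qed.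

Lemma bfs_ae_ideal x (g : S -> R) : measurable_fun setT g ->
  (\forall t \ae rho, `|g t| <= `|B x t|) ->
  exists2 y, (\forall t \ae rho, B y t = g t) & `|y| <= `|x|.
Proof.
move=> mg gx; have [y yg yx] := bfs_ideal mg gx.
by exists y => //; apply: filterS yg => t; exact.
Qed.

(** The ideal property only provides some preimage of the dominated function;
    injectivity identifies it with the given vector. *)
Lemma bfs_norm_le x y : (\forall t \ae rho, `|B x t| <= `|B y t|) -> `|x| <= `|y|.
Proof.
move=> h; have [z zx] := bfs_ae_ideal (@bfs_measurable _ _ _ _ _ B x) h.
by rewrite (@bfs_ae_inj z x).
Qed.

Lemma bfs_norm_fspace x (f : S -> R) : (\forall t \ae rho, B x t = f t) ->
  fs_norm (bfs_fspace B) f = `|x|%:E.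
Proof.
move=> xf; rewrite /=.
rewrite (_ : [set _ | _ in _] = [set `|x|%:E]) ?ereal_inf1//.
apply/seteqP; split => [_ [y yf <-]|_ ->] /=; last first.
  by exists x => //; apply: filterS xf.
congr (`|_|%:E); apply: bfs_ae_inj.
by apply: filterS2 xf yf => t -> ->.
Qed.

Definition bfs_abs x : X := xget 0 [set y | \forall t \ae rho, B y t = `|B x t|].

Lemma bfs_absE x : \forall t \ae rho, B (bfs_abs x) t = `|B x t|.
Proof.
rewrite /bfs_abs; case: xgetP => // h; exfalso.
have [|//|y /= hy _] := @bfs_ae_ideal x (fun t => `|B x t|).
- exact/measurableT_comp/bfs_measurable.
- by apply: aeW => t; rewrite normr_id.
- exact: (h y).
Qed.

Lemma bfs_abs_norm x : `|bfs_abs x| <= `|x|.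
Proof.
apply: bfs_norm_le; apply: filterS (bfs_absE x) => t ->.
by rewrite normr_id.
Qed.

Definition bfs_restr A x : X :=
  xget 0 [set y | \forall t \ae rho, B y t = B x t * \1_A t].

Lemma bfs_restrE A x : measurable A ->
  \forall t \ae rho, B (bfs_restr A x) t = B x t * \1_A t.
Proof.
move=> mA; rewrite /bfs_restr; case: xgetP => // h; exfalso.
have [|//|y /= hy _] := @bfs_ae_ideal x (fun t => B x t * \1_A t).
- apply: measurable_funM; first exact: bfs_measurable.
  exact: measurable_indic.
- apply: aeW => t; rewrite normrM indicE; case: (t \in A) => //=.
    by rewrite normr1 mulr1.
  by rewrite normr0 mulr0.
- exact: (h y).
Qed.

Lemma bfs_restr_norm A x : measurable A -> `|bfs_restr A x| <= `|x|.
Proof.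
move=> mA; apply: bfs_norm_le; apply: filterS (bfs_restrE x mA) => t ->.
rewrite normrM indicE; case: (t \in A) => //=.
  by rewrite normr1 mulr1.
by rewrite normr0 mulr0.
Qed.

Lemma bfs_restr_linear A (a : R) x y : measurable A ->
  bfs_restr A (a *: x + y) = a *: bfs_restr A x + bfs_restr A y.
Proof.
move=> mA; apply: bfs_ae_inj.
near=> t.
rewrite (near (bfs_lin a (bfs_restr A x) (bfs_restr A y)) t)//.
rewrite (near (bfs_restrE (a *: x + y) mA) t)//.
rewrite (near (bfs_restrE x mA) t)// (near (bfs_restrE y mA) t)//.
by rewrite (near (bfs_lin a x y) t)// mulrDl mulrA.
Unshelve. all: by end_near. Qed.

Lemma bfs_sign_avg (a : nat -> X) n x : \forall t \ae rho,
  B (sign_avg bfs_abs a n x) t = abs_avg (fun i => B (a i) t) n (B x t).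
Proof.
elim: n x => [|n IH] x /=; first exact: bfs_absE.
near=> t.
rewrite (near (bfs_aeZ 2^-1 (sign_avg bfs_abs a n (x + a n) +
   sign_avg bfs_abs a n (x - a n))) t)//.
rewrite (near (bfs_aeD (sign_avg bfs_abs a n (x + a n))
   (sign_avg bfs_abs a n (x - a n))) t)//.
rewrite (near (IH (x + a n)) t)// (near (IH (x - a n)) t)//.
by rewrite (near (bfs_aeD x (a n)) t)// (near (bfs_aeB x (a n)) t).
Unshelve. all: by end_near. Qed.

Lemma bfs_sign_avg_norm (a : nat -> X) n C :
  (forall s : nat -> bool, `|\sum_(i < n) (-1) ^+ s i *: a i| <= C) ->
  `|sign_avg bfs_abs a n 0| <= C.
Proof.
move=> h; apply: (@sign_avg_le _ _ (fun x => `|x|)).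
- exact: ler_normD.
- by move=> k x k0; rewrite normrZ ger0_norm.
- by move=> s; rewrite add0r (le_trans (bfs_abs_norm _)).
Qed.

(** The square function of a finite family is dominated by a vector of [X] whose
    norm is controlled by the signed sums of the family: this replaces any
    convexity or type assumption on [X]. *)
Lemma bfs_square_le (a : nat -> X) n : \forall t \ae rho,
  \sum_(i < n) B (a i) t ^+ 2 <= 4 * B (sign_avg bfs_abs a n 0) t ^+ 2.
Proof.
apply: filterS2 bfs_ae0 (bfs_sign_avg a n 0) => t -> ->.
exact: khintchine.
Qed.

Lemma bfs_unif_ac (K : set (S -> R)) (P : set X) :
  unif_ac rho (bfs_fspace B) K ->
  (forall x, P x -> exists2 f, K f & \forall t \ae rho, B x t = f t) ->
  forall e : R, 0 < e -> exists2 dlt : R, 0 < dlt &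
    forall A, measurable A -> (rho A < dlt%:E)%E ->
      forall x, P x -> `|bfs_restr A x| < e.
Proof.
move=> uac KP e e0; have [dlt dlt0 h] := uac e e0.
exists dlt => // A mA rA x Px; have [f Kf xf] := KP x Px.
rewrite -lte_fin; apply: le_lt_trans (h A mA rA).
apply: ereal_sup_ubound; exists f => //.
apply: bfs_norm_fspace; apply: filterS2 xf (bfs_restrE x mA).
by move=> t + ->/= => ->.
Qed.

End bfs_theory.

(** * Arrays forbidden by subsequence splitting *)

Lemma measurable_lt_fun d (T : measurableType d) (R : realType) (f g : T -> R) :
  measurable_fun setT f -> measurable_fun setT g ->
  measurable [set t | f t < g t].
Proof.
move=> mf mg; have := measurable_fun_ltr mf mg measurableT (Y := [set true]) I.
by rewrite setTI; congr (measurable _); apply/seteqP; split => t.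
Qed.

Section pigeonhole.
Context d (S : measurableType d) (R : realType).
Variables (mu : {finite_measure set S -> \bar R}).

(** Sets that cover almost every point at most [c] times have total measure at
    most [c * mu setT], so that one among [n] of them is small. *)
Lemma measure_pigeonhole (E : nat -> set S) n (c dlt : R) :
  (forall i, measurable (E i)) -> 0 <= c ->
  (\forall t \ae mu, \sum_(i < n) (\1_(E i) t : R) <= c) ->
  c * fine (mu setT) < n%:R * dlt ->
  exists2 i, (i < n)%N & (mu (E i) < dlt%:E)%E.
Proof.
move=> mE c0 Ec cn; apply: contrapT => hn.
have big i : (i < n)%N -> (dlt%:E <= mu (E i))%E.
  by move=> iltn; rewrite leNgt; apply/negP => h; apply: hn; exists i.
have : (\int[mu]_t (\sum_(i <- index_enum 'I_n) (\1_(E i) t)%:E) <=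
        \int[mu]_t (cst c%:E t))%E.
  apply: ae_ge0_le_integral => //.
  - by move=> t _; apply: sume_ge0.
  - apply: emeasurable_sum => i; apply/measurable_EFinP.
    exact: measurable_indic.
  - by apply: filterS Ec => t h _; rewrite sumEFin lee_fin.
rewrite ge0_integral_sum//; last first.
  by move=> i; apply/measurable_EFinP; exact: measurable_indic.
rewrite integral_cst//.
under eq_bigr do rewrite integral_indic// setIT.
rewrite [X in (_ <= c%:E * X)%E](_ : _ = (fine (mu setT))%:E); last first.
  by rewrite fineK// fin_num_measure.
rewrite leNgt => /negP; apply.
rewrite -EFinM; apply: (@lt_le_trans _ _ (\sum_(i < n) dlt%:E)%E).
  by rewrite sumEFin lte_fin sumr_const card_ord -mulr_natl.
by apply: lee_sum => i _; exact: big.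
Qed.

Lemma disjoint_small_measure (A : nat -> set S) (dlt : R) k :
  (forall i, measurable (A i)) -> 0 < dlt ->
  (forall i j, i != j -> \forall t \ae mu, ~ (A i t /\ A j t)) ->
  exists2 i, (k <= i)%N & (mu (A i) < dlt%:E)%E.
Proof.
move=> mA dlt0 dA.
have [n hn] : exists n : nat, 1 * fine (mu setT) < n%:R * dlt.
  exists (Num.truncn (fine (mu setT) / dlt)).+1.
  by rewrite mul1r -ltr_pdivrMr// truncnS_gt.
have [//|//||//|i ltin mi] := @measure_pigeonhole (fun i => A (k + i)%N) n 1 dlt.
 have : \forall t \ae mu, forall i j : 'I_n, i != j ->
      ~ (A (k + i)%N t /\ A (k + j)%N t).
    apply: filter_forall => i; apply: filter_forall => j.
    have [->|ij] := eqVneq i j; first exact: aeW.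
    by apply: filterS (dA (k + i)%N (k + j)%N _) => //; rewrite eqn_add2l.
  apply: filterS => t h.
  have [[i0 Ai0]|nA] := pselect (exists i : 'I_n, A (k + i)%N t).
    rewrite (bigD1 i0)//= big1 ?addr0 ?indicE ?mem_set// => i ii0.
    by rewrite indicE memNset// => Ai; exact: (h i i0).
  rewrite big1// => i _.
  by rewrite indicE memNset// => Ai; apply: nA; exists i.
by exists (k + i)%N => //; rewrite leq_addr.
Qed.

End pigeonhole.

Section no_c0_array.
Context d (S : measurableType d) (R : realType).
Variables (rho : {finite_measure set S -> \bar R}) (X : completeNormedModType R).
Variable B : bfs rho X.
Hypothesis sspX : ssp rho (bfs_fspace B).

(** The finite rows behave like unit vector bases of c_0 spaces of growing
    dimension; the condition on the columns prevents the rows from escaping into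
    the disjoint part of a splitting. *)
Lemma ssp_no_c0_array (u : nat -> nat -> X) (C e : R) : 0 < e ->
  (forall N (s : nat -> bool), `|\sum_(i < N) (-1) ^+ s i *: u N i| <= C) ->
  (forall i e', 0 < e' -> exists2 dlt : R, 0 < dlt &
    forall A, measurable A -> (rho A < dlt%:E)%E ->
    forall N, `|bfs_restr B A (u N i)| < e') ->
  ~ (forall N i, (i < N)%N -> e <= `|u N i|).
Proof.
move=> e0 uC uac ue.
have C0 : 0 <= C by have := uC 0%N (fun=> false); rewrite big_ord0 normr0.
pose v N := sign_avg (bfs_abs B) (u N) N 0.
have vC N : `|v N| <= C by apply: bfs_sign_avg_norm; exact: uC.
have [| |s [g [h [s_incr gh fgh uac_g dish]]]] := sspX.2 (fun N => B (v N)).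
- move=> N; split; first exact: bfs_measurable.
  by exists (v N); exact: aeW.
- exists C => N; rewrite (@bfs_norm_fspace _ _ _ _ _ _ (v N)) ?lee_fin//.
  exact: aeW.
have /choice[G GE] : forall n, exists x, \forall t \ae rho, B x t = g n t.
  move=> n; have [[_ [x xg]] _] := gh n.
  by exists x; apply: filterS xg => t; exact.
have mg n : measurable_fun setT (g n) by have [[]] := gh n.
have mh n : measurable_fun setT (h n) by have [_ []] := gh n.
have {}fgh n : \forall t \ae rho, B (v (s n)) t = g n t + h n t.
  by have [+ _] := fgh n; apply: filterS => t; exact.
pose A n := [set t | h n t != 0].
have mA n : measurable (A n).
  rewrite (_ : A n = h n @^-1` (~` [set 0])); last first.
    by apply/seteqP; split => t /= /eqP.
  by rewrite -[X in measurable X]setTI; apply: mh => //; exact: measurableC.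
(* An entry is cut into three parts: over [A j], over the set [E i] where it
   exceeds [dl * g], and over the rest. Their norms are below [e / 4],
   [2 * (e / 8)] and [dl * C <= e / 4]. *)
pose dl := e / (4 * (C + 1)).
have dl0 : 0 < dl by rewrite divr_gt0// mulr_gt0// ltr_wpDl.
have dlC : dl * C <= e / 4.
  rewrite /dl invfM mulrA -mulrA ler_piMr//; first by rewrite divr_ge0// ltW.
  by rewrite mulrC ler_pdivrMr ?ltr_wpDl// mul1r lerDl.
have e8 : 0 < e / 8 by rewrite divr_gt0.
have [|d0 d00 Gd0] := bfs_unif_ac (B := B) (P := range G) uac_g _ e8.
  by move=> _ [j _ <-]; exists (g j); [exists j|exact: GE].
(* By Khintchine's inequality, a point lies in at most [c] of the sets [E i]. *)
pose c := 4 / dl ^+ 2.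
have c0 : 0 <= c by rewrite divr_ge0 ?sqr_ge0.
have [n hn] : exists n : nat, c * fine (rho setT) < n%:R * d0.
  exists (Num.truncn (c * fine (rho setT) / d0)).+1.
  by rewrite -ltr_pdivrMr// truncnS_gt.
have [d1 d10 ud1] : exists2 d1 : R, 0 < d1 &
    forall i, (i < n)%N -> forall D, measurable D -> (rho D < d1%:E)%E ->
    forall N, `|bfs_restr B D (u N i)| < e / 4.
  elim: n {hn} => [|n [d1 d10 IH]]; first by exists 1.
  have [|d2 d20 h2] := uac n (e / 4); first by rewrite divr_gt0.
  exists (Num.min d1 d2); first by rewrite lt_min d10.
  move=> i + D mD rD N; rewrite ltnS leq_eqVlt => /predU1P[->|ltin].
    by apply: h2 => //; apply: lt_le_trans rD _; rewrite lee_fin ge_min lexx orbT.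
  by apply: IH => //; apply: lt_le_trans rD _; rewrite lee_fin ge_min lexx.
have [j nj Aj] : exists2 j, (n <= j)%N & (rho (A j) < d1%:E)%E.
  apply: disjoint_small_measure => // i j ij.
  have := dish i j ij; apply: filterS => t hij [/eqP hi /eqP hj].
  by case: hij.
have nsj : (n <= s j)%N.
  apply: leq_trans nj _; elim: j {Aj} => // j IH.
  exact: leq_ltn_trans IH (s_incr _ _ (ltnSn j)).
pose a i := u (s j) i.
pose E i := ~` A j `&` [set t | dl * `|g j t| < `|B (a i) t|].
have mE i : measurable (E i).
  apply: measurableI; first exact: measurableC.
  apply: measurable_lt_fun; last first.
    by apply: measurableT_comp => //; exact: bfs_measurable.
  by apply: measurable_funM => //; exact: measurableT_comp.
have vg : \forall t \ae rho, ~ A j t -> B (v (s j)) t = g j t.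
  apply: filterS (fgh j) => t -> /negP; rewrite negbK => /eqP ->.
  by rewrite addr0.
have sq : \forall t \ae rho, ~ A j t ->
    \sum_(i < n) B (a i) t ^+ 2 <= 4 * g j t ^+ 2.
  apply: filterS2 vg (bfs_square_le B (u (s j)) (s j)) => t vgt h' nAt.
  rewrite -(vgt nAt); apply: le_trans h'.
  rewrite (big_ord_widen _ (fun i => B (a i) t ^+ 2) nsj) big_mkcond/=.
  by apply: ler_sum => i _; case: ifP => // _; exact: sqr_ge0.
have [|i ltin Ei] := measure_pigeonhole mE c0 _ hn.
  apply: filterS sq => t h'.
  have [At|nAt] := pselect (A j t).
    by rewrite big1// => i _; rewrite indicE memNset// => -[].
  have {}h' := h' nAt.
  have step i : (\1_(E i) t : R) * (dl ^+ 2 * g j t ^+ 2) <= B (a i) t ^+ 2.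
    rewrite indicE; case: (boolP (t \in E i)) => [/set_mem[_ /= lt]|_].
      rewrite mul1r -exprMn -(real_normK (num_real (dl * _))).
      rewrite -[leRHS](real_normK (num_real _)) ler_sqr ?nnegrE//.
      by rewrite normrM gtr0_norm// ltW.
    by rewrite mul0r sqr_ge0.
  have [g0|gn0] := eqVneq (g j t) 0.
    rewrite big1// => i _; rewrite indicE memNset// => -[_ /=].
    rewrite g0 normr0 mulr0 normr_gt0 => Bi.
    have : B (a i) t ^+ 2 <= 0.
      apply: le_trans (_ : _ <= \sum_(i < n) B (a i) t ^+ 2) _; last first.
        by rewrite (le_trans h')// g0 expr0n mulr0.
      by rewrite (bigD1 i)//= lerDl sumr_ge0// => k _; exact: sqr_ge0.
    by rewrite leNgt exprn_even_gt0//= Bi.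
  have g2 : 0 < g j t ^+ 2 by rewrite exprn_even_gt0.
  rewrite /c ler_pdivlMr ?exprn_gt0// -(ler_pM2r g2) -mulrA.
  apply: le_trans h'; rewrite mulr_suml; apply: ler_sum => i _; exact: step.
pose F := ~` A j `\` E i.
have mF : measurable F by apply: measurableD => //; exact: measurableC.
have split3 : a i = bfs_restr B (A j) (a i) + bfs_restr B (E i) (a i)
    + bfs_restr B F (a i).
  apply: (bfs_ae_inj (B := B)); near=> t.
  rewrite (near (bfs_aeD B (bfs_restr B (A j) (a i) + bfs_restr B (E i) (a i))
    (bfs_restr B F (a i))) t)//.
  rewrite (near (bfs_aeD B (bfs_restr B (A j) (a i)) (bfs_restr B (E i) (a i))) t)//.
  rewrite (near (bfs_restrE B (a i) (mA j)) t)//.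
  rewrite (near (bfs_restrE B (a i) (mE i)) t)//.
  rewrite (near (bfs_restrE B (a i) mF) t)//.
  rewrite -!mulrDr !indicE.
  have [At|nAt] := pselect (A j t).
    by rewrite (mem_set At) !memNset ?addr0 ?mulr1// => -[].
  rewrite (memNset nAt) add0r.
  have [Et|nEt] := pselect (E i t).
    by rewrite (mem_set Et) memNset ?addr0 ?mulr1// => -[].
  by rewrite (memNset nEt) (mem_set (_ : F t)) ?add0r ?mulr1.
have nA : `|bfs_restr B (A j) (a i)| < e / 4 by exact: ud1.
have nE : `|bfs_restr B (E i) (a i)| <= 2 * `|bfs_restr B (E i) (G j)|.
  rewrite -[X in X * _]gtr0_norm// -normrZ; apply: (bfs_norm_le (B := B)).
  near=> t.
  rewrite (near (bfs_aeZ B 2 (bfs_restr B (E i) (G j))) t)//.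
  rewrite (near (bfs_restrE B (a i) (mE i)) t)//.
  rewrite (near (bfs_restrE B (G j) (mE i)) t)// (near (GE j) t)//.
  rewrite indicE; case: (boolP (t \in E i)) => [/set_mem[nAt _]|_]; last first.
    by rewrite !mulr0.
  rewrite !mulr1 -ler_sqr ?nnegrE// !real_normK ?num_real// exprMn.
  rewrite (_ : 2 ^+ 2 = 4) -?natrX//.
  apply: le_trans ((near sq t) _ nAt) => //.
  by rewrite (bigD1 (Ordinal ltin))//= lerDl sumr_ge0// => k _; exact: sqr_ge0.
have nG : `|bfs_restr B (E i) (G j)| < e / 8 by apply: Gd0 => //; exists j.
have nF : `|bfs_restr B F (a i)| <= dl * `|v (s j)|.
  rewrite -[X in X * _]gtr0_norm// -normrZ; apply: (bfs_norm_le (B := B)).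
  near=> t.
  rewrite (near (bfs_aeZ B dl (v (s j))) t)//.
  rewrite (near (bfs_restrE B (a i) mF) t)//.
  rewrite indicE; case: (boolP (t \in F)) => [/set_mem[nAt nEt]|_]; last first.
    by rewrite mulr0 normr0.
  rewrite mulr1 normrM gtr0_norm// ((near vg t) _ nAt)// leNgt.
  by apply/negP => lt; apply: nEt.
have := ue (s j) i (leq_trans ltin nsj); rewrite -/(a i) leNgt => /negP; apply.
have h1 : dl * `|v (s j)| <= dl * C by rewrite ler_pM2l.
have := ler_normD (bfs_restr B (A j) (a i)) (bfs_restr B (E i) (a i)).
have := ler_normD (bfs_restr B (A j) (a i) + bfs_restr B (E i) (a i))
  (bfs_restr B F (a i)).
rewrite -split3; lra.
Unshelve. all: by end_near. Qed.

End no_c0_array.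

(** * Norming functionals *)

Section dual.
Context {R : realType} {X : completeNormedModType R}.

Lemma dual_of_bounded (f : X -> R) (C : R) :
  (forall k x y, f (k *: x + y) = k * f x + f y) ->
  (forall x, `|f x| <= C * `|x|) ->
  exists phi : banach_dual X, forall x, phi x = f x.
Proof.
move=> lf fC.
pose g : {linear X -> R^o} :=
  HB.pack (f : X -> R^o) (GRing.isLinear.Build _ _ _ _ (f : X -> R^o) lf).
have cg : continuous g.
  apply: bounded_linear_continuous; apply/linear_boundedP.
  near=> r => x; apply: le_trans (fC x) _.
  by apply: ler_wpM2r => //; near: r; apply: nbhs_pinfty_ge; exact: num_real.
by exists (Dual cg).
Unshelve. all: by end_near. Qed.

Lemma dual_ballP (phi : banach_dual X) :
  dual_ball phi <-> forall x, `|phi x : R| <= `|x|.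
Proof.
split=> [h x|h]; last first.
  apply: ge_ereal_sup => _ [x /= x1 <-]; rewrite lee_fin.
  exact: le_trans (h x) x1.
have [->|xn0] := eqVneq x 0; first by rewrite linear0 !normr0.
have x0 : 0 < `|x| by rewrite normr_gt0.
have : (`|phi (`|x|^-1 *: x) : R|%:E <= 1)%E.
  apply: le_trans h; apply: ereal_sup_ubound; exists (`|x|^-1 *: x) => //=.
  by rewrite normrZ normfV normr_id mulVf// gt_eqF.
rewrite linearZ/= lee_fin normrM normfV normr_id.
by rewrite ler_pdivrMl// mulr1.
Qed.

Section norming.
Variable v : X.

(** Partial linear functionals dominated by the norm are represented by their
    graphs, so that Zorn's lemma applies to inclusion of sets. Functionality is
    a consequence of domination, see [graph_fun]. *)
Let graph (G : set (X * R)) := [/\ G (v, `|v|),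
  forall k x a y b, G (x, a) -> G (y, b) -> G (k *: x + y, k * a + b) &
  forall x a, G (x, a) -> a <= `|x|].

Let line := [set p : X * R | exists k, p = (k *: v, k * `|v|)].

Let graph_line : graph line.
Proof.
split.
- by exists 1; rewrite scale1r mul1r.
- move=> k x a y b [k1 [-> ->]] [k2 [-> ->]]; exists (k * k1 + k2).
  by rewrite scalerDl scalerA mulrDl mulrA.
- by move=> x a [k [-> ->]]; rewrite normrZ ler_wpM2r// ler_norm.
Qed.

Let graph0 G : graph G -> G (0, 0).
Proof.
move=> [Gv Gl _]; have := Gl (-1) _ _ _ _ Gv Gv.
by rewrite scaleN1r mulN1r !addNr.
Qed.

Let graphZ G k x a : graph G -> G (x, a) -> G (k *: x, k * a).
Proof.
move=> gG Gx; have := graph0 gG; case: gG => _ Gl _ G0.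
by have := Gl k _ _ _ _ Gx G0; rewrite !addr0.
Qed.

Let graph_fun G x a b : graph G -> G (x, a) -> G (x, b) -> a = b.
Proof.
move=> [_ Gl Gle] Ga Gb; have := Gle _ _ (Gl (-1) _ _ _ _ Ga Gb).
have := Gle _ _ (Gl (-1) _ _ _ _ Gb Ga).
by rewrite scaleN1r addNr normr0 !mulN1r; lra.
Qed.

(** The value at [x0] of an extension must lie between these bounds, and they are
    compatible by the triangle inequality for [(x + x0) + (y - x0)]. *)
Let graph_bound G x0 : graph G -> exists c, forall x a, G (x, a) ->
  a - `|x - x0| <= c /\ c <= `|x + x0| - a.
Proof.
move=> gG; have G0 := graph0 gG; case: gG => _ Gl Gle.
pose E := [set y | exists x a, G (x, a) /\ y = a - `|x - x0|].
have EU x a : G (x, a) -> ubound E (`|x + x0| - a).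
  move=> Ga _ [y [b [Gb ->]]].
  have := Gle _ _ (Gl 1 _ _ _ _ Ga Gb); rewrite scale1r mul1r.
  have := ler_normD (x + x0) (y - x0); rewrite addrACA subrr addr0; lra.
have E0 : E !=set0 by exists (0 - `|0 - x0|), 0, 0.
exists (sup E) => x a Ga; split.
  apply: sup_upper_bound; last by exists x, a.
  by split => //; eexists; exact: EU G0.
by apply: ge_sup => //; exact: EU.
Qed.

Let graph_extend G x0 : graph G ->
  exists G', [/\ graph G', G `<=` G' & exists a, G' (x0, a)].
Proof.
move=> gG; have [c hc] := graph_bound x0 gG.
have G0 := graph0 gG; have [Gv Gl Gle] := gG.
exists [set p | exists x a t, G (x, a) /\ p = (x + t *: x0, a + t * c)]; split.
- split.
  + by exists v, `|v|, 0; rewrite scale0r mul0r !addr0.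
  + move=> k x a y b [x1 [a1 [t1 [G1 [-> ->]]]]] [x2 [a2 [t2 [G2 [-> ->]]]]].
    exists (k *: x1 + x2), (k * a1 + a2), (k * t1 + t2); split; first exact: Gl.
    by rewrite !scalerDr scalerDl scalerA addrACA; congr (_, _); ring.
  + move=> _ _ [x [a [t [Gx [-> ->]]]]].
    have [t0|t0|->] := ltrgtP t 0; last first.
    * by rewrite scale0r mul0r !addr0; exact: Gle.
    * have [_] := hc _ _ (graphZ t^-1 gG Gx).
      rewrite -(ler_pM2l t0) mulrBr mulVKf ?gt_eqF//.
      rewrite -[X in X * `|_|](gtr0_norm t0) -normrZ scalerDr scalerA.
      by rewrite mulfV ?gt_eqF// scale1r; lra.
    * have [+ _] := hc _ _ (graphZ (- t)^-1 gG Gx).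
      have s0 : 0 < - t by rewrite oppr_gt0.
      rewrite -(ler_pM2l s0) mulrBr mulVKf ?gt_eqF//.
      rewrite -[X in X * `|_|](gtr0_norm s0) -normrZ scalerBr scalerA.
      by rewrite mulfV ?gt_eqF// scale1r scaleNr opprK; lra.
- by move=> [x a] Gx; exists x, a, 0; rewrite scale0r mul0r !addr0.
- by exists c, 0, 0, 1; rewrite scale1r mul1r !add0r.
Qed.

(** Hahn-Banach for the functional mapping [k *: v] to [k * `|v|]: a maximal
    dominated graph containing this line is defined everywhere. *)
Lemma norming_functional : exists2 phi : banach_dual X,
  dual_ball phi & phi v = `|v|.
Proof.
have [|G [gG Gmax]] := @Zorn_bigcup (X * R)%type
    (* The empty set is added because the union of an empty chain is empty. *)
    [set G | G = set0 \/ graph G].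
  move=> F FP Ftot.
  have [[G FG gG]|nF] := pselect (exists2 G, F G & graph G); last first.
    left; apply/seteqP; split => // p [G FG Gp].
    have [G0|gG] := FP _ FG; first by rewrite G0 in Gp.
    by exfalso; apply: nF; exists G.
  right; split.
  - by exists G => //; case: gG.
  - move=> k x a y b [G1 FG1 G1x] [G2 FG2 G2y].
    have [H FH [Hx Hy]] : exists2 H, F H & H (x, a) /\ H (y, b).
      have [s|s] := Ftot _ _ FG1 FG2.
        by exists G2 => //; split => //; exact: s.
      by exists G1 => //; split => //; exact: s.
    have [H0|[_ Hl _]] := FP _ FH; first by rewrite H0 in Hx.
    by exists H => //; exact: Hl.
  - move=> x a [H FH Hx]; have [H0|[_ _ ]] := FP _ FH; last exact.
    by rewrite H0 in Hx.
have {}gG : graph G.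
  case: gG => // G0; exfalso; apply: (Gmax line); last by right.
  rewrite G0; split=> // l0; apply: (l0 (v, `|v|)).
  by case: graph_line.
have dom x : exists a, G (x, a).
  have [G' [gG' GG' [a G'a]]] := graph_extend x gG.
  exists a; apply: contrapT => nG; apply: (Gmax G'); last by right.
  by split => // G'G; apply: nG; exact: G'G.
have [f fG] := choice dom; have [Gv Gl Gle] := gG.
have fle x : f x <= `|x| by exact: Gle.
have flin k x y : f (k *: x + y) = k * f x + f y.
  by apply: (graph_fun gG (fG _)); exact: Gl.
have fN x : f (- x) = - f x.
  have := graphZ (-1) gG (fG x); rewrite scaleN1r mulN1r.
  exact: graph_fun gG (fG _).
have fC x : `|f x| <= `|x|.
  by rewrite ler_norml fle andbT lerNl -fN -[leRHS]normrN.
have [|phi phiE] := dual_of_bounded (C := 1) flin; first by move=> x; rewrite mul1r.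
exists phi; first by apply/dual_ballP => x; rewrite phiE.
by rewrite phiE; exact: (graph_fun gG (fG v)).
Qed.

End norming.

Lemma dual_separates (v w : X) :
  (forall phi : banach_dual X, phi v = phi w) -> v = w.
Proof.
move=> h; have [phi _] := norming_functional (v - w).
rewrite linearB h subrr => /esym/eqP; rewrite normr_eq0 => /eqP vw.
by apply/eqP; rewrite -subr_eq0; apply/eqP.
Qed.

Lemma dual_norm_le (v : X) (C : R) :
  (forall phi : banach_dual X, dual_ball phi -> `|phi v : R| <= C) -> `|v| <= C.
Proof.
move=> h; have [phi bphi phiv] := norming_functional v.
by apply: le_trans (h phi bphi); rewrite phiv normr_id.
Qed.

End dual.

(** * Weakly bounded sets *)

Section uniform_boundedness.
Context {R : realType} {X : completeNormedModType R}.
Variables (v : nat -> X) (phi : nat -> banach_dual X).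
Hypothesis phi_ball : forall n, dual_ball (phi n).
Hypothesis phi_norming : forall n, phi n (v n) = `|v n|.

Let q : R := 4^-1.

(** A gliding hump: the term [4 ^- k * phi k] is added only if the previous sum is
    not already large at [v k]. The value at [v k] is then at least half of
    [4 ^- k * `|v k|], while all later terms together contribute at most a third
    of it. *)
Fixpoint hump_sum n : X -> R :=
  if n is k.+1 then fun x => hump_sum k x +
    (if q ^+ k * `|v k| / 2 <= `|hump_sum k (v k)| then 0
     else q ^+ k * phi k x)
  else fun=> 0.

Lemma hump_sum_lin n k x y :
  hump_sum n (k *: x + y) = k * hump_sum n x + hump_sum n y.
Proof.
elim: n => [|n IH] /=; first by rewrite mulr0 addr0.
rewrite IH; case: ifP => _; first by rewrite !addr0.
by rewrite linearP /= /GRing.scale/=; ring.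
Qed.

Lemma hump_sum_ge n : q ^+ n * `|v n| / 2 <= `|hump_sum n.+1 (v n)|.
Proof.
rewrite /=; case: ifPn => [|]; first by rewrite addr0.
rewrite -ltNge phi_norming => h.
have qv : 0 <= q ^+ n * `|v n| by rewrite mulr_ge0 ?exprn_ge0 ?invr_ge0.
have := lerB_dist (q ^+ n * `|v n|) (- hump_sum n (v n)).
rewrite normrN opprK (ger0_norm qv) (addrC (hump_sum _ _)).
by move: h; set a := q ^+ n * _; lra.
Qed.

Let hump_step n x : `|hump_sum n.+1 x - hump_sum n x| <= q ^+ n * `|x|.
Proof.
have q0 : 0 <= q ^+ n by rewrite exprn_ge0 ?invr_ge0.
rewrite /= addrC addKr; case: ifP => _; first by rewrite normr0 mulr_ge0.
by rewrite normrM ger0_norm// ler_wpM2l//; exact: (dual_ballP _).1.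
Qed.

Let hump_tail n k x : `|hump_sum (n + k) x - hump_sum n x| <=
  4 / 3 * (q ^+ n - q ^+ (n + k)) * `|x|.
Proof.
elim: k => [|k IH]; first by rewrite addn0 !subrr normr0 mulr0 mul0r.
have := hump_step (n + k) x; rewrite addnS => h.
have := ler_normD (hump_sum (n + k) x - hump_sum n x)
  (hump_sum (n + k).+1 x - hump_sum (n + k) x).
rewrite addrC addrA subrK => h2; apply: (le_trans h2).
apply: le_trans (lerD IH h) _; rewrite exprSr /q.
by rewrite le_eqVlt; apply/orP; left; apply/eqP; field.
Qed.

(** The tails are geometric, whence the factor [4 / 3]. *)
Lemma hump_limit : exists f : banach_dual X,
  forall n x, `|(f x : R) - hump_sum n x| <= 4 / 3 * q ^+ n * `|x|.
Proof.
have q0 n : 0 <= q ^+ n by rewrite exprn_ge0 ?invr_ge0.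
have tail n m x : (n <= m)%N ->
    `|hump_sum m x - hump_sum n x| <= 4 / 3 * q ^+ n * `|x|.
  move=> nm; rewrite -(subnKC nm); apply: le_trans (hump_tail _ _ _) _.
  by rewrite ler_wpM2r// ler_wpM2l// gerBl.
have cv x : cvgn (hump_sum ^~ x).
  (* Subtracting a multiple of the geometric tail makes the sequence monotone. *)
  pose r m := hump_sum m x - 4 / 3 * `|x| * q ^+ m.
  have -> : hump_sum ^~ x = r \+ geometric (4 / 3 * `|x|) q.
    by apply/funext => m; rewrite /r /= subrK.
  apply: is_cvgD.
    apply: nondecreasing_is_cvgn.
      apply/nondecreasing_seqP => m; rewrite /r exprS.
      have := hump_step m x; rewrite ler_norml => /andP[+ _].
      by rewrite /q; lra.
    exists (4 / 3 * `|x|) => _ [m _ <-].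
    have := tail 0%N m x (leq0n m); rewrite subr0 expr0 mulr1.
    apply: le_trans; apply: le_trans (ler_norm _); rewrite /r gerBl.
    by rewrite mulr_ge0// mulr_ge0.
  apply: cvgP; apply: cvg_geometric.
  by rewrite ger0_norm ?invr_ge0// invf_lt1// ltr1n.
pose f x := limn (hump_sum ^~ x).
have fc x : hump_sum n x @[n --> \oo] --> f x by exact: cv.
have ft n x : `|f x - hump_sum n x| <= 4 / 3 * q ^+ n * `|x|.
  have h : `|hump_sum m x - hump_sum n x| @[m --> \oo] --> `|f x - hump_sum n x|.
    by apply: cvg_norm; apply: cvgB (fc x) _; exact: cvg_cst.
  rewrite -(cvg_lim _ h)//; apply: limr_le; first exact: cvgP h.
  by near=> m; apply: tail; near: m; exact: nbhs_infty_ge.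
have flin k x y : f (k *: x + y) = k * f x + f y.
  apply/cvg_lim => //; under eq_fun do rewrite hump_sum_lin.
  by apply: cvgD => //; apply: cvgMr.
have [|g gE] := dual_of_bounded (C := 4 / 3) flin.
  by move=> x; have := ft 0%N x; rewrite subr0 expr0 mulr1.
by exists g => n x; rewrite gE.
Unshelve. all: by end_near. Qed.

End uniform_boundedness.

(** If [K] were unbounded, it would contain vectors [v n] of norm more than
    [n * 4 ^ n], and the limit of the humps built on them would be unbounded on
    [K]. *)
Lemma weakly_bounded (R : realType) (X : completeNormedModType R) (K : set X) :
  (forall phi : banach_dual X, exists M, forall v, K v -> `|phi v : R| <= M) ->
  exists M, forall v, K v -> `|v| <= M.
Proof.
move=> wb; apply: contrapT => nb.
have big n : exists v, K v /\ n%:R * 4 ^+ n < `|v|.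
  apply: contrapT => h; apply: nb; exists (n%:R * 4 ^+ n) => v Kv.
  by rewrite leNgt; apply/negP => lt; apply: h; exists v.
have [v vK] := choice big.
have /choice[phi phiP] : forall n, exists phi : banach_dual X,
    dual_ball phi /\ phi (v n) = `|v n|.
  by move=> n; have [phi] := norming_functional (v n); exists phi.
have [f fP] := hump_limit v (fun n => (phiP n).1).
have [M fM] := wb f.
pose n := (Num.truncn (6 * M)).+1.
have := fM (v n) (vK n).1; rewrite leNgt => /negP; apply.
have := fP n.+1 (v n).
have := hump_sum_ge (fun n => (phiP n).2) n.
set a := hump_sum _ _ _ _; rewrite exprS => h1 h2.
have h3 : 6 * M < n%:R by exact: truncnS_gt.
have h4 : n%:R < 4^-1 ^+ n * `|v n|.
  by rewrite exprVn ltr_pdivlMl ?exprn_gt0// mulrC (vK n).2.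
have := lerB_dist a (a - f (v n)).
rewrite subKr (distrC a).
move: h2; rewrite -!mulrA => h2.
by move: h1 h2 h3 h4; set b := _ ^+ n * _; lra.
Qed.

(** * Integrals against the variation of a scalar measure *)

Section scalar_variation.
Context d (T : measurableType d) (R : realType).
Variables (X : completeNormedModType R) (m : vector_measure T X).
Variable phi : banach_dual X.

Local Notation pos := (jordan_pos (hahn_scalar m phi)).
Local Notation neg := (jordan_neg (hahn_scalar m phi)).
Local Notation P := (hahn_pos m phi).
Local Notation N := (hahn_neg m phi).
Local Notation var := (scalar_variation m phi).

Lemma measurable_hahn_pos : measurable P.
Proof. by case: (hahn_scalar m phi) => -[]. Qed.

Lemma measurable_hahn_neg : measurable N.
Proof. by case: (hahn_scalar m phi) => _ []. Qed.

Lemma scalar_variation_fin (A : set T) : measurable A -> var A \is a fin_num.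
Proof. by move=> mA; rewrite fin_numD !fin_num_measure. Qed.

Lemma jordan_pos_scalar A : measurable A -> pos A = (phi (m (A `&` P)) : R)%:E.
Proof. by move=> mA; rewrite jordan_posE charge.cjordan_posE /crestr0 mem_set. Qed.

Lemma jordan_neg_scalar A : measurable A -> neg A = (- phi (m (A `&` N)) : R)%:E.
Proof.
by move=> mA; rewrite jordan_negE charge.cjordan_negE /crestr0 mem_set.
Qed.

Lemma scalar_variation_le (A : set T) (c : R) : measurable A ->
  (forall D, measurable D -> D `<=` A -> `|phi (m D) : R| <= c) -> (var A <= (2 * c)%:E)%E.
Proof.
move=> mA h; rewrite (_ : var A = pos A + neg A)%E//.
rewrite jordan_pos_scalar// jordan_neg_scalar// -EFinD lee_fin.
have mAP : measurable (A `&` P) by apply: measurableI => //; exact: measurable_hahn_pos.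
have mAN : measurable (A `&` N) by apply: measurableI => //; exact: measurable_hahn_neg.
have := h _ mAP (@subIsetl _ _ _); have := h _ mAN (@subIsetl _ _ _); rewrite !ler_norml.
by move=> /andP[+ _] /andP[_]; lra.
Qed.

Lemma integral_scalar_variation A (f : T -> \bar R) : measurable A ->
  measurable_fun A f -> (forall t, A t -> (0 <= f t)%E) ->
  (\int[var]_(t in A) f t = \int[pos]_(t in A) f t + \int[neg]_(t in A) f t)%E.
Proof.
move=> mA mf f0; rewrite -ge0_integral_measure_add//.
by apply: eq_measure_integral => D mD DA; exact: esym (measure_addE _ _ _).
Qed.

Section integrand.
Variables (f : T -> R).
Hypotheses (mf : measurable_fun setT f) (intf : var.-integrable setT (EFin \o f)).

Let mfA A : measurable_fun A (EFin \o f).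
Proof. exact/measurable_EFinP/measurable_funTS. Qed.

Let mabs A : measurable_fun A (fun t => `|f t|%:E).
Proof.
by apply/measurable_EFinP/measurableT_comp => //; exact: measurable_funTS.
Qed.

Lemma scalar_variation_integrable_fin A : measurable A ->
  (\int[var]_(t in A) `|f t|%:E)%E \is a fin_num.
Proof.
move=> mA; have /integrableP[_] := integrableS measurableT mA (@subsetT _ A) intf.
by rewrite ge0_fin_numE ?integral_ge0// => t _; rewrite lee_fin.
Qed.

Let split A : measurable A -> (\int[var]_(t in A) `|f t|%:E =
  \int[pos]_(t in A) `|f t|%:E + \int[neg]_(t in A) `|f t|%:E)%E.
Proof. by move=> mA; rewrite integral_scalar_variation. Qed.

Let pos_ge0 A : (0 <= \int[pos]_(t in A) `|f t|%:E)%E.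
Proof. by apply: integral_ge0 => t _; rewrite lee_fin. Qed.

Let neg_ge0 A : (0 <= \int[neg]_(t in A) `|f t|%:E)%E.
Proof. by apply: integral_ge0 => t _; rewrite lee_fin. Qed.

Lemma jordan_pos_integrable A : measurable A -> pos.-integrable A (EFin \o f).
Proof.
move=> mA; apply/integrableP; split => //.
have := scalar_variation_integrable_fin mA; rewrite split// fin_numD.
by move=> /andP[+ _]; rewrite ge0_fin_numE.
Qed.

Lemma jordan_neg_integrable A : measurable A -> neg.-integrable A (EFin \o f).
Proof.
move=> mA; apply/integrableP; split => //.
have := scalar_variation_integrable_fin mA; rewrite split// fin_numD.
by move=> /andP[_ +]; rewrite ge0_fin_numE.
Qed.

Lemma scalar_integral_le A : measurable A ->
  (`|scalar_integral m phi A f| <= \int[var]_(t in A) `|f t|%:E)%E.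
Proof.
move=> mA; rewrite split// /scalar_integral.
apply: le_trans (lee_abs_sub _ _) _; apply: leeD.
  exact: (@le_abse_integral _ _ _ pos A (EFin \o f)).
exact: (@le_abse_integral _ _ _ neg A (EFin \o f)).
Qed.

Lemma scalar_integralU A D : measurable A -> measurable D -> [disjoint A & D] ->
  scalar_integral m phi (A `|` D) f =
  (scalar_integral m phi A f + scalar_integral m phi D f)%E.
Proof.
move=> mA mD AD; rewrite /scalar_integral !integral_setU//.
have i1 := integrable_fin_num mA (jordan_pos_integrable mA).
have i2 := integrable_fin_num mA (jordan_neg_integrable mA).
have i3 := integrable_fin_num mD (jordan_pos_integrable mD).
have i4 := integrable_fin_num mD (jordan_neg_integrable mD).
by rewrite fin_num_oppeD// addeACA.
Qed.

Let same_sign (mu : {measure set T -> \bar R}) D :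
  ((forall t, D t -> 0 <= f t) \/ (forall t, D t -> f t <= 0)) ->
  (\int[mu]_(t in D) `|f t|%:E = `|\int[mu]_(t in D) (f t)%:E|)%E.
Proof.
move=> [f0|f0].
  rewrite gee0_abs; last by apply: integral_ge0 => t /f0; rewrite lee_fin.
  by apply: eq_integral => t /set_mem/f0 ft; rewrite ger0_norm.
rewrite (_ : (\int[mu]_(t in D) (f t)%:E = - \int[mu]_(t in D) `|f t|%:E)%E).
  by rewrite abseN gee0_abs// integral_ge0// => t _; rewrite lee_fin.
rewrite -integral_ge0N; last by move=> t _; rewrite lee_fin.
by apply: eq_integral => t /set_mem/f0 ft; rewrite ler0_norm// EFinN oppeK.
Qed.

(** On a piece of the Hahn decomposition where [f] has a constant sign, the signed
    integral does not cancel. *)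
Lemma scalar_variation_piece D : measurable D -> (D `<=` P \/ D `<=` N) ->
  ((forall t, D t -> 0 <= f t) \/ (forall t, D t -> f t <= 0)) ->
  (\int[var]_(t in D) `|f t|%:E = `|scalar_integral m phi D f|)%E.
Proof.
move=> mD [DP|DN] sg; rewrite split// /scalar_integral.
  have n0 : neg D = 0%E.
    rewrite jordan_neg_scalar// (_ : D `&` N = set0) ?vector_measure0 ?linear0 ?oppr0//.
    have [_ _ _ PN] := hahn_scalar m phi.
    by rewrite -subset0 => t [/DP Pt Nt]; rewrite -PN.
  rewrite (null_set_integral _ _ n0)// (null_set_integral _ _ n0)//.
  by rewrite adde0 sube0; apply: same_sign.
have p0 : pos D = 0%E.
  rewrite jordan_pos_scalar// (_ : D `&` P = set0) ?vector_measure0 ?linear0//.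
  have [_ _ _ PN] := hahn_scalar m phi.
  by rewrite -subset0 => t [/DN Nt Pt]; rewrite -PN.
rewrite (null_set_integral _ _ p0)// (null_set_integral _ _ p0)//.
by rewrite add0e sub0e abseN; apply: same_sign.
Qed.

(** The Hahn decomposition and the sign of [f] cut [A] into four pieces without
    cancellation, one of which carries at least a quarter of the integral. *)
Lemma scalar_variation_quarter A : measurable A ->
  exists D, [/\ measurable D, D `<=` A &
    (\int[var]_(t in A) `|f t|%:E <= 4%:E * `|scalar_integral m phi D f|)%E].
Proof.
move=> mA; pose F := [set t | 0 <= f t].
have mF : measurable F.
  by rewrite /F -[X in measurable X]setTI; exact: measurable_fun_le.
have cover : A = ((A `&` P) `&` F `|` (A `&` P) `\` F) `|`
    ((A `&` N) `&` F `|` (A `&` N) `\` F).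
  have [_ _ PN _] := hahn_scalar m phi.
  by rewrite !setUIDK -setIUr PN setIT.
pose I (D : set T) := (\int[var]_(t in D) `|f t|%:E)%E.
have IU D1 D2 : measurable D1 -> measurable D2 -> [disjoint D1 & D2] ->
    I (D1 `|` D2) = (I D1 + I D2)%E.
  by move=> m1 m2 D12; rewrite /I ge0_integral_setU// => t _; rewrite lee_fin.
have mP := measurable_hahn_pos; have mN := measurable_hahn_neg.
have mAP := measurableI _ _ mA mP; have mAN := measurableI _ _ mA mN.
have mPF := measurableI _ _ mAP mF; have mPF' := measurableD mAP mF.
have mNF := measurableI _ _ mAN mF; have mNF' := measurableD mAN mF.
have PN0 : P `&` N = set0 by case: (hahn_scalar m phi).
have sumI : I A = (I (A `&` P `&` F) + I (A `&` P `\` F) +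
    (I (A `&` N `&` F) + I (A `&` N `\` F)))%E.
  rewrite {1}cover !IU//; try exact: measurableU.
  - by apply/disj_set2P; rewrite setDE setIACA setICr setI0.
  - by apply/disj_set2P; rewrite setDE setIACA setICr setI0.
  - by apply/disj_set2P; rewrite !setUIDK setIACA PN0 setI0.
have fP : forall t, F t -> 0 <= f t by [].
have fN : forall t, ~ F t -> f t <= 0.
  by move=> t /negP; rewrite -ltNge => /ltW.
have p1 := @scalar_variation_piece _ mPF
  (or_introl (fun t (h : (A `&` P `&` F) t) => h.1.2))
  (or_introl (fun t (h : (A `&` P `&` F) t) => fP t h.2)).
have p2 := @scalar_variation_piece _ mPF'
  (or_introl (fun t (h : (A `&` P `\` F) t) => h.1.2))
  (or_intror (fun t (h : (A `&` P `\` F) t) => fN t h.2)).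
have p3 := @scalar_variation_piece _ mNF
  (or_intror (fun t (h : (A `&` N `&` F) t) => h.1.2))
  (or_introl (fun t (h : (A `&` N `&` F) t) => fP t h.2)).
have p4 := @scalar_variation_piece _ mNF'
  (or_intror (fun t (h : (A `&` N `\` F) t) => h.1.2))
  (or_intror (fun t (h : (A `&` N `\` F) t) => fN t h.2)).
apply: contrapT => h.
have small D : measurable D -> D `<=` A -> I D = `|scalar_integral m phi D f|%E ->
    (4%:E * I D < I A)%E.
  move=> mD DA e; rewrite ltNge; apply/negP => le; apply: h.
  by exists D; rewrite -e.
have := small _ mPF (fun t h => h.1.1) p1.
have := small _ mPF' (fun t h => h.1.1) p2.
have := small _ mNF (fun t h => h.1.1) p3.
have := small _ mNF' (fun t h => h.1.1) p4.
have Ifin D : measurable D -> exists r : R, I D = r%:E.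
  by move=> mD; exists (fine (I D)); rewrite fineK//;
     exact: scalar_variation_integrable_fin.
have [r1 e1] := Ifin _ mPF; have [r2 e2] := Ifin _ mPF'.
have [r3 e3] := Ifin _ mNF; have [r4 e4] := Ifin _ mNF'.
rewrite sumI e1 e2 e3 e4.
rewrite -!EFinM -!EFinD !lte_fin; lra.
Qed.

End integrand.
End scalar_variation.

(** * The integral with values in the space *)

Section vector_integral.
Context d (T : measurableType d) (R : realType).
Variables (X : completeNormedModType R) (m : vector_measure T X).

Local Notation var := (scalar_variation m).

Definition vm_int (f : T -> R) (A : set T) : X := xget 0 [set v |
  forall phi : banach_dual X, (phi v : R)%:E = scalar_integral m phi A f].

Lemma scalar_integral_restrict phi (f : T -> R) A D :
  scalar_integral m phi D (f \* \1_A) = scalar_integral m phi (D `&` A) f.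
Proof.
have e (mu : {measure set T -> \bar R}) :
    (\int[mu]_(t in D) ((f \* \1_A) t)%:E = \int[mu]_(t in D `&` A) (f t)%:E)%E.
  rewrite integral_mkcondr; apply: eq_integral => t _.
  by rewrite -patch_indic /patch; case: ifP.
by rewrite /scalar_integral !e.
Qed.

Lemma scalar_variation_restrict (mu : {measure set T -> \bar R}) (f : T -> R) A D :
  (\int[mu]_(t in D) `|(f \* \1_A) t|%:E = \int[mu]_(t in D `&` A) `|f t|%:E)%E.
Proof.
rewrite integral_mkcondr; apply: eq_integral => t _.
by rewrite -patch_indic /patch; case: ifP => //; rewrite normr0.
Qed.

Lemma vm_integrable_restrict (f : T -> R) A : measurable A ->
  vm_integrable m f -> vm_integrable m (f \* \1_A).
Proof.
move=> mA [mf intf intX]; split.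
- by apply: measurable_funM => //; exact: measurable_indic.
- move=> phi; rewrite -patch_indic -restrict_EFin.
  apply/(integrable_mkcond _ mA); apply: integrableS (intf phi) => //.
- move=> D mD; have [v vE] := intX _ (measurableI _ _ mD mA).
  by exists v => phi; rewrite vE scalar_integral_restrict.
Qed.

Lemma scalar_integral1 phi A : measurable A ->
  scalar_integral m phi A (cst 1) = (phi (m A) : R)%:E.
Proof.
move=> mA.
have e (mu : {measure set T -> \bar R}) :
    (\int[mu]_(t in A) (cst 1%R t : R)%:E = mu A)%E.
  by rewrite -[RHS]mul1e -(integral_cst mu mA).
rewrite /scalar_integral !e.
by rewrite -[RHS]/(scalar_fun m phi A) (jordan_decomp (hahn_scalar m phi) mA) /cadd/= cscaleN1.
Qed.

Lemma vm_integrable1 : vm_integrable m (cst 1).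
Proof.
split => //.
- move=> phi; apply/integrableP; split; first exact/measurable_EFinP.
  have e : (\int[var phi]_t `|(EFin \o cst (1%R : R)) t| = var phi setT)%E.
    rewrite -[RHS]mul1e -(integral_cst (var phi) measurableT).
    by apply: eq_integral => t _ /=; rewrite normr1.
  by rewrite e -ge0_fin_numE//; exact: scalar_variation_fin.
- by move=> A mA; exists (m A) => phi; rewrite scalar_integral1.
Qed.

Lemma vm_int1 A : measurable A -> vm_int (cst 1) A = m A.
Proof.
move=> mA; apply: dual_separates => phi; apply: EFin_inj.
rewrite /vm_int; case: xgetP => [v -> h|/(_ (m A))[]].
  by rewrite h scalar_integral1.
by move=> psi; rewrite /= scalar_integral1.
Qed.

Section integrable.
Variable f : T -> R.
Hypothesis intf : vm_integrable m f.

Let mf : measurable_fun setT f. Proof. by case: intf. Qed.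

Let inte phi : (var phi).-integrable setT (EFin \o f).
Proof. by case: intf. Qed.

Lemma vm_intE A (phi : banach_dual X) : measurable A ->
  (phi (vm_int f A) : R)%:E = scalar_integral m phi A f.
Proof.
move=> mA; rewrite /vm_int; case: xgetP => [v -> h|h]; first exact: h.
by have [_ _ /(_ A mA)[v vE]] := intf; have := h v vE.
Qed.

Lemma vm_int_dual_le A (phi : banach_dual X) : measurable A ->
  (`|phi (vm_int f A) : R|%:E <= \int[var phi]_(t in A) `|f t|%:E)%E.
Proof. by move=> mA; rewrite -abse_EFin vm_intE// scalar_integral_le. Qed.

Lemma vm_int_norm_le A c : measurable A ->
  (forall phi, dual_ball phi -> (\int[var phi]_(t in A) `|f t|%:E <= c%:E)%E) ->
  `|vm_int f A| <= c.
Proof.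
move=> mA h; apply: dual_norm_le => phi bphi; rewrite -lee_fin.
exact: le_trans (vm_int_dual_le _ mA) (h _ bphi).
Qed.

Lemma vm_int_quarter A (phi : banach_dual X) : measurable A ->
  exists D, [/\ measurable D, D `<=` A &
    (\int[var phi]_(t in A) `|f t|%:E <= (4 * `|phi (vm_int f D) : R|)%:E)%E].
Proof.
move=> mA; have [D [mD DA h]] := scalar_variation_quarter mf (inte phi) mA.
by exists D; split => //; rewrite EFinM -abse_EFin vm_intE.
Qed.

Lemma vm_intU A D : measurable A -> measurable D -> [disjoint A & D] ->
  vm_int f (A `|` D) = vm_int f A + vm_int f D.
Proof.
move=> mA mD AD; apply: dual_separates => phi; apply: EFin_inj.
rewrite linearD EFinD !vm_intE//; last exact: measurableU.
exact: scalar_integralU.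
Qed.

Lemma vm_int0 : vm_int f set0 = 0.
Proof.
have := @vm_intU set0 set0 measurable0 measurable0; rewrite setU0 => h.
have /h/eqP : [disjoint (@set0 T) & set0] by apply/disj_set2P; rewrite setI0.
by rewrite -subr_eq0 opprD addrA subrr sub0r oppr_eq0 => /eqP.
Qed.

(** The scalar integrals are bounded for each functional separately by
    integrability; the uniform bound is the uniform boundedness principle. *)
Lemma vm_int_bounded : exists M, forall A, measurable A -> `|vm_int f A| <= M.
Proof.
have [phi|M hM] := @weakly_bounded _ _ [set vm_int f A | A in measurable].
  exists (fine (\int[var phi]_(t in setT) `|f t|%:E)%E) => _ [A mA <-].
  have fin := scalar_variation_integrable_fin (inte phi) measurableT.
  rewrite -lee_fin fineK//; apply: le_trans (vm_int_dual_le phi mA) _.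
  apply: ge0_subset_integral => //.
  by apply/measurable_EFinP; exact: measurableT_comp.
by exists M => A mA; apply: hM; exists A.
Qed.

(** Collecting the sets with positive and with negative sign turns a bound on the
    integrals of [f] into a bound on all signed sums over disjoint sets. *)
Lemma vm_int_signed_sum (D : nat -> set T) n (s : nat -> bool) :
  (forall i, measurable (D i)) -> trivIset setT D ->
  exists U V, [/\ measurable U, measurable V &
    \sum_(i < n) (-1) ^+ s i *: vm_int f (D i) = vm_int f U - vm_int f V].
Proof.
move=> mD tD.
suff [U [V [mU mV [UD VD e]]]] : exists U V, [/\ measurable U, measurable V & [/\
    U `<=` \bigcup_(i in [set i | (i < n)%N]) D i,
    V `<=` \bigcup_(i in [set i | (i < n)%N]) D i &
    \sum_(i < n) (-1) ^+ s i *: vm_int f (D i) = vm_int f U - vm_int f V]].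
  by exists U, V.
elim: n => [|n [U [V [mU mV [UD VD e]]]]].
  by exists set0, set0; split => //; split => //; rewrite big_ord0 subrr.
have disj W : W `<=` \bigcup_(i in [set i | (i < n)%N]) D i -> [disjoint W & D n].
  move=> WD; apply/disj_set2P; rewrite -subset0 => t [/WD[i /= ltin Dit] Dnt].
  have := tD i n I I (ex_intro _ t (conj Dit Dnt)) => ein.
  by rewrite ein ltnn in ltin.
have widen W : W `<=` \bigcup_(i in [set i | (i < n)%N]) D i ->
    W `<=` \bigcup_(i in [set i | (i < n.+1)%N]) D i.
  by move=> WD t /WD[i /= ltin Dit]; exists i => //=; exact: ltnW.
have last : D n `<=` \bigcup_(i in [set i | (i < n.+1)%N]) D i.
  by move=> t Dnt; exists n => /=.
case sn: (s n).
  exists U, (V `|` D n); split => //; first exact: measurableU.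
  split; [exact: widen|by rewrite subUset; split => //; exact: widen|].
  by rewrite big_ord_recr/= e sn expr1 scaleN1r vm_intU ?opprD ?addrA//; exact: disj.
exists (U `|` D n), V; split => //; first exact: measurableU.
split; [by rewrite subUset; split => //; exact: widen|exact: widen|].
by rewrite big_ord_recr/= e sn expr0 scale1r vm_intU 1?addrAC//; exact: disj.
Qed.

Lemma vm_L1norm_restrict A :
  fs_norm (L1 m) (f \* \1_A) =
  ereal_sup [set (\int[var phi]_(t in A) `|f t|%:E)%E | phi in @dual_ball R X].
Proof.
rewrite /=; congr ereal_sup; apply: eq_imagel => phi _.
by rewrite scalar_variation_restrict setTI.
Qed.

(** The constant 4 comes from [vm_int_quarter]. *)
Lemma vm_L1norm_le A c : measurable A ->
  (forall D, measurable D -> D `<=` A -> `|vm_int f D| <= c) ->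
  (fs_norm (L1 m) (f \* \1_A)%R <= (4 * c)%:E)%E.
Proof.
move=> mA h; rewrite vm_L1norm_restrict; apply: ge_ereal_sup => _ [phi bphi <-].
have [D [mD DA le]] := vm_int_quarter phi mA.
apply: le_trans le _; rewrite lee_fin ler_pM2l//.
exact: le_trans ((dual_ballP _).1 bphi _) (h D mD DA).
Qed.

Lemma bounded_scalar_variation_le phi A k : measurable A -> 0 <= k ->
  (forall t, A t -> `|f t| <= k) ->
  (\int[var phi]_(t in A) `|f t|%:E <= k%:E * var phi A)%E.
Proof.
move=> mA k0 fk; apply: (@integral_le_bound _ _ _ (var phi) A (EFin \o f) k%:E) => //.
- by apply/measurable_EFinP; exact: measurable_funTS.
- by apply: aeW => t At; rewrite lee_fin fk.
Qed.

(** For a fixed bound on the integrand, the integral inherits the smallness of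
    [m]. *)
Lemma vm_int_bounded_le A k c : measurable A -> 0 <= k ->
  (forall t, A t -> `|f t| <= k) ->
  (forall D, measurable D -> D `<=` A -> `|m D| <= c) ->
  `|vm_int f A| <= k * (2 * c).
Proof.
move=> mA k0 fk mc; apply: vm_int_norm_le => // phi bphi.
apply: le_trans (bounded_scalar_variation_le phi mA k0 fk) _.
rewrite EFinM lee_wpmul2l ?lee_fin//; apply: scalar_variation_le => // D mD DA.
exact: le_trans ((dual_ballP _).1 bphi _) (mc D mD DA).
Qed.

End integrable.

End vector_integral.

(** * Absolute continuity of the integral *)

Section absolute_continuity.
Context dS (S : measurableType dS) (R : realType).
Variables (rho : {finite_measure set S -> \bar R}) (X : completeNormedModType R).
Variable B : bfs rho X.
Context d (T : measurableType d) (m : vector_measure T X).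

Local Notation var := (scalar_variation m).

(** Restriction to [E] is a contraction of [X], so that a functional of norm at
    most 1 composed with it is again one; its scalar measure only sees the
    restrictions to [E] of the values of [m]. *)
Lemma vm_int_restr_le (f : T -> R) E D (k c : R) : vm_integrable m f ->
  measurable E -> measurable D -> 0 <= k ->
  (forall t, D t -> `|f t| <= k) ->
  (forall A, measurable A -> `|bfs_restr B E (m A)| <= c) ->
  `|bfs_restr B E (vm_int m f D)| <= k * (2 * c).
Proof.
move=> intf mE mD k0 fk mc; apply: dual_norm_le => phi /dual_ballP bphi.
have [|x|psi psiE] := @dual_of_bounded _ _ (fun x => phi (bfs_restr B E x) : R) 1.
- by move=> a x y; rewrite bfs_restr_linear// linearP.
- by rewrite mul1r (le_trans (bphi _))// bfs_restr_norm.
rewrite -psiE -lee_fin; apply: le_trans (vm_int_dual_le intf psi mD) _.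
apply: le_trans (bounded_scalar_variation_le intf psi mD k0 fk) _.
rewrite EFinM lee_wpmul2l ?lee_fin//; apply: scalar_variation_le => // A mA _.
by rewrite psiE; exact: le_trans (bphi _) (mc _ mA).
Qed.

Hypothesis sspX : ssp rho (bfs_fspace B).

Lemma bfs_ac x e : 0 < e -> exists2 dlt : R, 0 < dlt &
  forall A, measurable A -> (rho A < dlt%:E)%E -> `|bfs_restr B A x| < e.
Proof.
move=> e0; have [|dlt dlt0 h] := sspX.1 (B x) _ e e0.
- split; first exact: bfs_measurable.
  by exists x; exact: aeW.
exists dlt => // A mA rA; rewrite -lte_fin.
by rewrite -(bfs_norm_fspace (bfs_restrE B x mA)); exact: h.
Qed.

(** The integral is only known to be weakly countably additive. If the claim fails,
    there are sets [A n] of summable measure over which the integrals are large.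
    Their upper limit is null for the semivariation, so that for each functional
    separately the tails [U p] become negligible. Removing a far tail from [A n] keeps half of the norm of
    the integral, and iterating this produces disjoint sets. *)
Lemma vm_int_ac (x0 : banach_dual X) (f : T -> R) (e : R) : rybakov m x0 ->
  vm_integrable m f -> 0 < e -> exists2 dlt : R, 0 < dlt &
  forall A, measurable A -> (var x0 A < dlt%:E)%E -> `|vm_int m f A| < e.
Proof.
move=> ryb intf e0; apply: contrapT => nac.
have bad n : exists A, [/\ measurable A,
    (var x0 A < (1 / (2 ^ n.+1)%:R)%:E)%E & e <= `|vm_int m f A|].
  apply: contrapT => h; apply: nac.
  exists (1 / (2 ^ n.+1)%:R); first by rewrite divr_gt0// ltr0n expn_gt0.
  move=> A mA vA; rewrite ltNge; apply/negP => le; apply: h.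
  by exists A.
have {bad} [A AP] := choice bad.
have mA n : measurable (A n) by case: (AP n).
pose U n := \bigcup_(j in [set j | (n <= j)%N]) A j.
have mU n : measurable (U n) by apply: bigcup_measurable.
have mlim : measurable (lim_sup_set A).
  by apply: bigcap_measurable => // k _; exact: mU.
have null : semivariation m (lim_sup_set A) = 0%E.
  apply/(ryb _ mlim)/lim_sup_set_cvg0 => //.
  apply: le_lt_trans (ltry 1).
  apply: le_trans (epsilon_trick0 xpredT (ler01 : 0 <= 1 :> R)).
  by apply: lee_nneseries => // n _; case: (AP n) => _ /ltW.
have cv phi : dual_ball phi -> var phi (U n) @[n --> \oo] --> (0 : \bar R)%E.
  move=> bphi; have -> : 0%E = var phi (lim_sup_set A).
    apply/eqP; rewrite eq_le measure_ge0/= -null.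
    by apply: ereal_sup_ubound; exists phi.
  apply: lim_sup_set_cvg => //.
  by rewrite -ge0_fin_numE// scalar_variation_fin//; exact: (mU 0%N).
(* The functional norming the integral over [A n] determines how far the tail has
   to be. *)
have next n : exists p, (n < p)%N /\ e / 2 <= `|vm_int m f (A n `\` U p)|.
  have [phi bphi phiv] := norming_functional (vm_int m f (A n)).
  have intphi : (var phi).-integrable setT (EFin \o f) by case: intf.
  have e2 : 0 < e / 2 by rewrite divr_gt0.
  have [dlt [dlt0 h]] := integral_normr_continuous intphi e2.
  have : \forall p \near \oo, (var phi (U p) < dlt%:E)%E.
    have : nbhs (0 : \bar R)%E [set y : \bar R | (y < dlt%:E)%E].
      by apply: ereal_normedtype.open_ereal_lt'; rewrite lte_fin.
    exact: (cv phi bphi).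
  move=> near_p; near \oo => p.
  have Up : (var phi (U p) < dlt%:E)%E by near: p.
  exists p; split; first by near: p; exact: nbhs_infty_gt.
  have mAU : measurable (A n `&` U p) by exact: measurableI.
  have mAD : measurable (A n `\` U p) by exact: measurableD.
  have small : `|phi (vm_int m f (A n `&` U p)) : R| < e / 2.
    have vAU : (var phi (A n `&` U p) < dlt%:E)%E.
      by apply: le_lt_trans Up; apply: le_measure; rewrite ?inE.
    rewrite -lte_fin; apply: le_lt_trans (vm_int_dual_le intf phi mAU) _.
    have := h _ mAU vAU; rewrite /Rintegral -lte_fin fineK//.
    exact: scalar_variation_integrable_fin.
  have [_ _ eA] := AP n.
  have : `|phi (vm_int m f (A n `\` U p)) : R| <= `|vm_int m f (A n `\` U p)|.
    exact: (dual_ballP _).1.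
  apply: le_trans; apply: le_trans (ler_norm _).
  have : (phi (vm_int m f (A n)) : R) =
     phi (vm_int m f (A n `&` U p)) + phi (vm_int m f (A n `\` U p)).
    rewrite -linearD -vm_intU// ?setUIDK//.
    by apply/disj_set2P; rewrite setDE setIACA setICr setI0.
  rewrite phiv; move: small eA; rewrite ltr_norml => /andP[_].
  by move=> h1 h2 h3; lra.
have [nx nxP] := choice next.
pose s k := iter k nx 0%N.
have s_incr i j : (i < j)%N -> (s i.+1 <= s j)%N.
  elim: j => // j IH; rewrite ltnS leq_eqVlt => /predU1P[->//|ij].
  by apply: leq_trans (IH ij) _; rewrite ltnW//; exact: (nxP _).1.
pose D i := A (s i) `\` U (s i.+1).
have mD i : measurable (D i) by exact: measurableD.
have tD : trivIset setT D.
  apply: ltn_trivIset => j i ij.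
  rewrite -subset0 => t [[_ nU] [At _]]; apply: nU.
  by exists (s j) => //=; exact: s_incr.
have [M hM] := vm_int_bounded intf.
apply: (@ssp_no_c0_array _ _ _ _ _ B sspX (fun _ i => vm_int m f (D i)) (M + M) (e / 2)).
- by rewrite divr_gt0.
- move=> n sg; have [V [W [mV mW ->]]] := vm_int_signed_sum intf n sg mD tD.
  by rewrite (le_trans (ler_normB _ _))// lerD// hM.
- move=> i e' e'0; have [dlt dlt0 h] := bfs_ac (vm_int m f (D i)) e'0.
  by exists dlt => // E mE rE _; exact: h.
- by move=> _ i _; exact: (nxP (s i)).2.
Unshelve. all: by end_near. Qed.

End absolute_continuity.

(** * Level bands of a bounded sequence *)

Section splitting.
Context dS (S : measurableType dS) (R : realType).
Variables (rho : {finite_measure set S -> \bar R}) (X : completeNormedModType R).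
Variable B : bfs rho X.
Context d (T : measurableType d) (m : vector_measure T X).
Hypothesis sspX : ssp rho (bfs_fspace B).

Local Notation var := (scalar_variation m).

(** Up to a factor 4, a bound [c] on the norm of [f \* \1_A] in L^1(m); this form
    is subadditive in [A] by the additivity of the integral. *)
Definition small_int (f : T -> R) A (c : R) :=
  forall D, measurable D -> D `<=` A -> `|vm_int m f D| <= c.

Lemma small_int_split (f : T -> R) A D (a b : R) : vm_integrable m f ->
  measurable D -> small_int f (A `&` D) a -> small_int f (A `\` D) b ->
  small_int f A (a + b).
Proof.
move=> intf mD sa sb E mE EA.
have m1 : measurable (E `&` D) by exact: measurableI.
have m2 : measurable (E `\` D) by exact: measurableD.
rewrite -(setUIDK E D) vm_intU//; last first.
  by apply/disj_set2P; rewrite setDE setIACA setICr setI0.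
apply: le_trans (ler_normD _ _) _; apply: lerD.
  by apply: sa => //; exact: setSI.
by apply: sb => //; exact: setSD.
Qed.

Definition band (f : T -> R) (k l : nat) := [set t | k%:R < `|f t| <= l%:R].

Lemma measurable_gt_level (f : T -> R) (k : R) : measurable_fun setT f ->
  measurable [set t | k < `|f t|].
Proof. by move=> mf; apply: measurable_lt_fun => //; exact: measurableT_comp. Qed.

Section bounded_sequence.
Variable f : nat -> T -> R.
Hypothesis intf : forall n, vm_integrable m (f n).
Variable M : R.
Hypothesis fM : forall n D, measurable D -> `|vm_int m (f n) D| <= M.

Let mf n : measurable_fun setT (f n). Proof. by case: (intf n). Qed.

(** The integrals over the bands of one function are the rows of an array. The
    bands of a fixed index have the common bound [l i.+1], which makes its columns
    uniformly absolutely continuous. *)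
Lemma no_uniform_bands (e : R) (l : nat -> nat) :
  unif_ac rho (bfs_fspace B) [set B (m A) | A in measurable] ->
  0 < e -> (forall i, (l i < l i.+1)%N) ->
  ~ (forall N, exists n, forall i, (i < N)%N ->
      ~ small_int (f n) (band (f n) (l i) (l i.+1)) e).
Proof.
move=> uac e0 l_incr bad.
have pick N : exists nD : nat * (nat -> set T), forall i,
    [/\ measurable (nD.2 i), nD.2 i `<=` band (f nD.1) (l i) (l i.+1) &
      (i < N)%N -> e <= `|vm_int m (f nD.1) (nD.2 i)|].
  have [n bn] := bad N.
  suff /choice[D DP] : forall i, exists D,
      [/\ measurable D, D `<=` band (f n) (l i) (l i.+1) &
        (i < N)%N -> e <= `|vm_int m (f n) D|] by exists (n, D).
  move=> i; have [iN|iN] := ltnP i N; last by exists set0; split => //; exact: sub0set.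
  apply: contrapT => h; apply: (bn i iN) => D mD DA.
  rewrite leNgt; apply/negP => /ltW le; apply: h.
  by exists D.
have [nD nDP] := choice pick.
pose n N := (nD N).1; pose D N i := (nD N).2 i.
have mD N i : measurable (D N i) by case: (nDP N i).
have Dband N i : D N i `<=` band (f (n N)) (l i) (l i.+1) by case: (nDP N i).
have l_mono i j : (i < j)%N -> (l i.+1 <= l j)%N.
  elim: j => // j IH; rewrite ltnS leq_eqVlt => /predU1P[->//|/IH h].
  exact: leq_trans h (ltnW (l_incr _)).
have tD N : trivIset setT (D N).
  apply: ltn_trivIset => j i ij.
  rewrite -subset0 => t [/Dband/andP[_ h2] /Dband/andP[h1 _]].
  by have := lt_le_trans h1 h2; rewrite ltr_nat ltnNge l_mono.
apply: (@ssp_no_c0_array _ _ _ _ _ B sspX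
  (fun N i => vm_int m (f (n N)) (D N i)) (M + M) e) => //.
- move=> N sg.
  have [V [W [mV mW ->]]] := vm_int_signed_sum (intf (n N)) N sg (mD N) (tD N).
  by rewrite (le_trans (ler_normB _ _))// lerD// fM.
- move=> i e' e'0; set k : R := (l i.+1)%:R.
  have k0 : 0 <= k by exact: ler0n.
  have c0 : 0 < e' / (2 * (k + 1)).
    by rewrite divr_gt0// mulr_gt0// ltr_wpDl.
  have [|dlt dlt0 h] := bfs_unif_ac (B := B) (P := [set m A | A in measurable])
    uac _ c0.
    by move=> _ [A mA <-]; exists (B (m A)); [exists A|exact: aeW].
  exists dlt => // E mE rE N.
  apply: (@le_lt_trans _ _ (k * (2 * (e' / (2 * (k + 1)))))).
    apply: vm_int_restr_le => //.
      by move=> t /Dband/andP[].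
    by move=> A mA; apply/ltW/h => //; exists A.
  have k1 : 0 < k + 1 by rewrite ltr_wpDl.
  rewrite (_ : k * _ = k / (k + 1) * e'); last by field; rewrite gt_eqF.
  by rewrite gtr_pMl// ltr_pdivrMr// mul1r ltrDl.
- by move=> N i iN; case: (nDP N i) => _ _; exact.
Qed.

(** If the indices with a small band do not form a member of the ultrafilter, then
    those with a large band do. Finitely many members meet, so the bands needed by
    [no_uniform_bands] are large for a common index. *)
Lemma uniform_bands (U : set_system nat) : UltraFilter U ->
  unif_ac rho (bfs_fspace B) [set B (m A) | A in measurable] ->
  forall e : R, 0 < e -> exists k, forall l,
    U [set n | small_int (f n) (band (f n) k l) e].
Proof.
move=> ultraU uac e e0; apply: contrapT => no.
have /choice[nx nxP] : forall k, exists l, (k < l)%N /\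
    U [set n | ~ small_int (f n) (band (f n) k l) e].
  move=> k; apply: contrapT => h; apply: no; exists k => l.
  have [//|Ul] := in_ultra_setVsetC [set n | small_int (f n) (band (f n) k l) e] ultraU.
  exfalso; apply: h; exists l; split=> //.
  have [n /= nsm] := filter_ex Ul.
  rewrite ltnNge; apply/negP => lk; apply: nsm => D mD Dband.
  rewrite (_ : D = set0) ?vm_int0 ?normr0 ?ltW//.
  rewrite -subset0 => t /Dband/andP[h1 h2].
  by have := lt_le_trans h1 h2; rewrite ltr_nat ltnNge lk.
apply: (@no_uniform_bands e (fun i => iter i nx 0%N)) => //.
  by move=> i; exact: (nxP _).1.
move=> N.
have : U [set n | forall i : 'I_N, ~ small_int (f n)
    (band (f n) (iter i nx 0%N) (iter i.+1 nx 0%N)) e].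
  by apply: filter_forall => i; exact: (nxP _).2.
move=> /filter_ex[n /= h]; exists n => i iN.
exact: (h (Ordinal iN)).
Qed.

(** Chebyshev's inequality: the integral of [`|f n|] for the variation of
    [x0 \o m] is at most a multiple of the bound [M]. *)
Lemma uniform_level (x0 : banach_dual X) (dlt : R) : 0 < dlt -> exists L : nat,
  forall n, (var x0 [set t | L%:R < `|f n t|]%R < dlt%:E)%E.
Proof.
move=> dlt0.
have [K K0 hK] : exists2 K : R, 0 < K & forall v, `|x0 v : R| <= K * `|v|.
  have /linear_bounded_continuous/linear_boundedP h := @dual_continuous _ _ x0.
  by have [K K0 hK] := pinfty_ex_gt0 h; exists K.
have M0 : 0 <= M by exact: le_trans (fM 0%N measurable0).
pose L := (Num.truncn (4 * (K * M) / dlt)).+1.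
exists L => n; set A := [set t | _].
have mA : measurable A by exact: measurable_gt_level.
have [D [mD DA le]] := vm_int_quarter (intf n) x0 mA.
have L0 : 0 < L%:R :> R by rewrite ltr0n.
have : (L%:R%:E * var x0 A <= (4 * (K * M))%:E)%E.
  rewrite -(integral_cst (var x0) mA).
  apply: le_trans (le_trans le _); last first.
    rewrite lee_fin ler_pM2l//; apply: le_trans (hK _) _.
    by rewrite ler_pM2l// fM.
  apply: ge0_le_integral => //.
  - by move=> t _; rewrite /= lee_fin ltW.
  - by apply/measurable_EFinP; apply: measurableT_comp => //; exact: measurable_funTS.
  - by move=> t At; rewrite /= lee_fin ltW.
have /fineK <- := scalar_variation_fin m x0 mA.
rewrite -EFinM lee_fin lte_fin => h.
rewrite -(ltr_pM2l L0); apply: le_lt_trans h _.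
by rewrite -ltr_pdivrMr// truncnS_gt.
Qed.

End bounded_sequence.
End splitting.

(** * Choice of the subsequence and splitting *)

Section selection.
Context d (T : measurableType d) (R : realType) (X : completeNormedModType R).
Variables (m : vector_measure T X) (eta : {measure set T -> \bar R}).
Variable f : nat -> T -> R.
Hypothesis intf : forall n, vm_integrable m (f n).
Hypothesis ac : forall (g : T -> R) (e : R), vm_integrable m g -> 0 < e ->
  exists2 dlt : R, 0 < dlt &
  forall A, measurable A -> (eta A < dlt%:E)%E -> `|vm_int m g A| < e.
Hypothesis level : forall dlt : R, 0 < dlt -> exists L : nat,
  forall n, (eta [set t | L%:R < `|f n t|]%R < dlt%:E)%E.
Variable U : set_system nat.
Hypothesis UF : ProperFilter U.
Hypothesis U_free : \oo `<=` U.
Variable k : nat -> nat.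
Hypothesis kU : forall q l,
  U [set n | small_int m (f n) (band (f n) (k q) l) q.+1%:R^-1].

(** Each level is chosen so high that the level set is small compared with the
    tolerances [dlt] of all the earlier functions, and the index is then taken in
    the member of [U] where the bands for [1 / q.+1], [q <= j], are small. *)
Lemma good_subsequence : exists (n L : nat -> nat) (dlt : nat -> R),
  [/\ {homo n : i j / (i < j)%N},
      forall j q, (q <= j)%N ->
        small_int m (f (n j)) (band (f (n j)) (k q) (L j)) q.+1%:R^-1,
      forall i j, (i < j)%N ->
        (eta [set t | (L j)%:R < `|f (n j) t|]%R <=
         (dlt i / 2 / (2 ^ (j - i))%:R)%:E)%E,
      forall j, 0 < dlt j &
      forall j A, measurable A -> (eta A < (dlt j)%:E)%E ->
        `|vm_int m (f (n j)) A| < j.+1%:R^-1].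
Proof.
(* A state consists of the index, the level and the tolerance of one step. *)
pose St := (nat * nat * R)%type.
pose good (j : nat) (x y : St) := [/\ (x.1.1 < y.1.1)%N,
  forall q, (q <= j)%N ->
    small_int m (f y.1.1) (band (f y.1.1) (k q) y.1.2) q.+1%:R^-1,
  (eta [set t | (y.1.2)%:R < `|f y.1.1 t|]%R < (x.2 / 4)%:E)%E,
  0 < y.2 <= x.2 / 2 &
  forall A, measurable A -> (eta A < (y.2)%:E)%E ->
    `|vm_int m (f y.1.1) A| < j.+1%:R^-1].
have step (jx : nat * St) : exists y, 0 < jx.2.2 -> good jx.1 jx.2 y.
  case: jx => j [[n0 L0] d0] /=.
  have [d00|d0n] := ltP 0 d0; last by exists (0%N, 0%N, 0).
  have [L hL] := level (divr_gt0 d00 (ltr0n R 4)).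
  have : U [set n | (n0 < n)%N /\ forall q : 'I_j.+1,
      small_int m (f n) (band (f n) (k q) L) q.+1%:R^-1].
    apply: filterI; first by apply: U_free; exact: nbhs_infty_gt.
    by apply: filter_forall => q; exact: kU.
  move=> /filter_ex[n /= [n0n hq]].
  have [|d1 d10 hd1] := ac (e := j.+1%:R^-1) (intf n).
    by rewrite invr_gt0.
  exists (n, L, Num.min d1 (d0 / 2)) => _; split => //=.
  - by move=> q qj; exact: (hq (Ordinal (qj : (q < j.+1)%N))).
  - by rewrite lt_min d10 divr_gt0//= ge_min lexx orbT.
  - move=> A mA eA; apply: hd1 => //; apply: lt_le_trans eA _.
    by rewrite lee_fin ge_min lexx.
have [F FP] := choice step.
pose st := fix st j := if j is i.+1 then F (j, st i) else F (0%N, (0%N, 0%N, 1)).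
pose prev j := if j is i.+1 then st i else (0%N, 0%N, 1).
have stE j : st j = F (j, prev j) by case: j.
have st_good j : good j (prev j) (st j).
  elim: j => [|j IH]; first by rewrite stE; apply: FP => /=.
  by rewrite stE; apply: FP => /=; case: IH => _ _ _ /andP[].
exists (fun j => (st j).1.1), (fun j => (st j).1.2), (fun j => (st j).2).
have halve i j : (i <= j)%N -> (st j).2 <= (st i).2 / (2 ^ (j - i))%:R.
  elim: j => [|j IH]; first by rewrite leqn0 => /eqP ->; rewrite expn0 divr1.
  rewrite leq_eqVlt => /predU1P[->|]; first by rewrite subnn expn0 divr1.
  rewrite ltnS => ij; rewrite subSn// expnSr natrM invfM mulrA.
  have [_ _ _ /andP[_ h] _] := st_good j.+1.
  apply: le_trans h _; rewrite ler_pM2r ?invr_gt0//; exact: IH.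
split.
- apply: homo_ltn; first exact: ltn_trans.
  by move=> i; case: (st_good i.+1).
- by move=> j q qj; case: (st_good j) => _ + _ _ _; apply.
- move=> i [//|j]; rewrite ltnS => ij; have [_ _ h _ _] := st_good j.+1.
  apply: le_trans (ltW h) _; rewrite lee_fin subSn// expnS natrM invfM.
  have := halve i j ij => /= h1.
  by move: h1; set a := (2 ^ (j - i))%:R^-1; lra.
- by move=> j; case: (st_good j) => _ _ _ /andP[].
- by move=> j A mA; case: (st_good j) => _ _ _ _; apply.
Qed.

End selection.

Section assembly.
Context d (T : measurableType d) (R : realType) (X : completeNormedModType R).
Variables (m : vector_measure T X) (eta : {measure set T -> \bar R}).
Hypothesis ac : forall (g : T -> R) (e : R), vm_integrable m g -> 0 < e ->
  exists2 dlt : R, 0 < dlt &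
  forall A, measurable A -> (eta A < dlt%:E)%E -> `|vm_int m g A| < e.

Lemma L1_ac_norm : ac_norm eta (L1 m).
Proof.
move=> f intf e e0; have [|dlt dlt0 h] := ac intf (e := e / 8).
  by rewrite divr_gt0.
exists dlt => // A mA eA.
apply: (@le_lt_trans _ _ (4 * (e / 8))%:E); last by rewrite lte_fin; lra.
apply: vm_L1norm_le => // D mD DA; apply/ltW/h => //.
by apply: le_lt_trans eA; apply: le_measure; rewrite ?inE.
Qed.

(** [W j] is the union of the level sets after [A j], and [A j `\` W j] are the
    disjoint supports. What remains of the [j]-th function lives on [W j], where it
    is small by the choice of the tolerances, and below the level [L j], where it
    consists of a bounded part and of a part in the small band above [k q]. *)
Lemma splitting_of_subsequence (f : nat -> T -> R) (k : nat -> nat)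
    (n L : nat -> nat) (dlt : nat -> R) :
  (forall n, vm_integrable m (f n)) ->
  {homo n : i j / (i < j)%N} ->
  (forall j q, (q <= j)%N ->
    small_int m (f (n j)) (band (f (n j)) (k q) (L j)) q.+1%:R^-1) ->
  (forall i j, (i < j)%N ->
    (eta [set t | (L j)%:R < `|f (n j) t|]%R <=
      (dlt i / 2 / (2 ^ (j - i))%:R)%:E)%E) ->
  (forall j, 0 < dlt j) ->
  (forall j A, measurable A -> (eta A < (dlt j)%:E)%E ->
    `|vm_int m (f (n j)) A| < j.+1%:R^-1) ->
  exists (s : nat -> nat) (g h : (T -> R)^nat),
    [/\ {homo s : i j / (i < j)%N},
        forall n, fs_mem (L1 m) (g n) /\ fs_mem (L1 m) (h n),
        forall n, f (s n) = g n \+ h n %[ae eta] /\ disjoint_supp eta (g n) (h n),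
        unif_ac eta (L1 m) (range g) &
        forall i j, i != j -> disjoint_supp eta (h i) (h j)].
Proof.
move=> intf n_incr bandP levelP dlt0 acP.
have mf i : measurable_fun setT (f i) by case: (intf i).
pose A j := [set t | (L j)%:R < `|f (n j) t|].
have mA j : measurable (A j) by exact: measurable_gt_level.
pose W j := \bigcup_i A (j + i.+1)%N.
have mW j : measurable (W j) by apply: bigcupT_measurable => i; exact: mA.
have etaW j : (eta (W j) < (dlt j)%:E)%E.
  apply: (@le_lt_trans _ _ (dlt j / 2)%:E).
    have := measure_sigma_subadditive eta (fun i => mA (j + i.+1)%N) (mW j)
      (@subset_refl _ _) => /le_trans; apply.
    apply: le_trans (epsilon_trick0 xpredT (ltW (divr_gt0 (dlt0 j) (ltr0n R 2)))).
    apply: lee_nneseries => // i _.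
    have := @levelP j (j + i.+1)%N; rewrite addKn; apply.
    by rewrite addnS ltnS leq_addr.
  by rewrite lte_fin; have := dlt0 j; lra.
pose H j := A j `\` W j.
have mH j : measurable (H j) by exact: measurableD.
have disjH i j : (i < j)%N -> H i `&` H j = set0.
  move=> ij; rewrite -subset0 => t [[_ nW] [At _]]; apply: nW.
  by exists (j - i.+1)%N => //; rewrite addnS -addSn subnKC.
exists n, (fun j => f (n j) \* \1_(~` H j)), (fun j => f (n j) \* \1_(H j)).
split => //.
- by move=> j; split; apply: vm_integrable_restrict => //; exact: measurableC.
- move=> j; split; apply: aeW => t /=.
    move=> _; rewrite -mulrDr !indicE in_setC.
    by case: (t \in H j); rewrite /= ?addr0 ?add0r mulr1.
  by rewrite !indicE in_setC; case: (t \in H j); rewrite /= mulr0; [left|right].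
- move=> e e0.
  (* The norm is at most 4 times [e / 8], and [e / 8] is shared by [W j] and the
     band, [e / 32] each, and by the part bounded by [K], [2 * (e / 32)]; the
     finitely many functions with [j < q] are treated one by one. *)
  have e32 : 0 < e / 32 by rewrite divr_gt0.
  pose q := Num.truncn (e / 32)^-1.
  have hq j : (q <= j)%N -> j.+1%:R^-1 <= e / 32.
    move=> qj; rewrite -[leRHS]invrK lef_pV2 ?posrE ?invr_gt0//.
    by apply: ltW; apply: lt_le_trans (truncnS_gt _) _; rewrite ler_nat.
  pose K : R := (k q)%:R.
  have K0 : 0 <= K by exact: ler0n.
  have [|d1 d10 hd1] := ac (vm_integrable1 m) (e := e / (32 * (K + 1))).
    by rewrite divr_gt0// mulr_gt0// ltr_wpDl.
  have [d2 d20 hd2] : exists2 d2 : R, 0 < d2 & forall j, (j < q)%N ->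
      forall D, measurable D -> (eta D < d2%:E)%E -> `|vm_int m (f (n j)) D| < e / 8.
    elim: q {hq K K0 d1 d10 hd1} => [|q [d2 d20 IH]]; first by exists 1.
    have [|d3 d30 h3] := ac (intf (n q)) (e := e / 8); first by rewrite divr_gt0.
    exists (Num.min d2 d3); first by rewrite lt_min d20.
    move=> j + D mD eD; rewrite ltnS leq_eqVlt => /predU1P[->|jq].
      by apply: h3 => //; apply: lt_le_trans eD _; rewrite lee_fin ge_min lexx orbT.
    by apply: IH => //; apply: lt_le_trans eD _; rewrite lee_fin ge_min lexx.
  exists (Num.min d1 d2); first by rewrite lt_min d10.
  move=> D mD eD.
  apply: (@le_lt_trans _ _ (4 * (e / 8))%:E); last by rewrite lte_fin; lra.
  apply: ge_ereal_sup => _ [_ [j _ <-] <-].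
  have -> : (f (n j) \* \1_(~` H j)) \* \1_D = f (n j) \* (\1_(~` H j `&` D)).
    by rewrite indicI; apply/funext => t /=; rewrite mulrA.
  apply: vm_L1norm_le => //.
    by apply: measurableI => //; exact: measurableC.
  have le_eta (V : set T) : measurable V -> V `<=` ~` H j `&` D ->
      (eta V < d1%:E)%E /\ (eta V < d2%:E)%E.
    move=> mV VD; have eV : (eta V <= eta D)%E.
      by apply: le_measure; rewrite ?inE// => t /VD[].
    split; apply: le_lt_trans eV _; apply: lt_le_trans eD _.
      by rewrite lee_fin ge_min lexx.
    by rewrite lee_fin ge_min lexx orbT.
  have [jq|qj] := ltnP j q.
    by move=> V mV VD; apply/ltW/(hd2 j jq) => //; exact: (le_eta V mV VD).2.
  rewrite (_ : e / 8 = e / 32 + (2 * (e / 32) + e / 32)); last by lra.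
  apply: (small_int_split (D := W j)) => //.
    move=> V mV VW; apply: le_trans (ltW (acP j V mV _)) (hq j qj).
    apply: le_lt_trans (etaW j); apply: le_measure; rewrite ?inE//.
    by move=> t /VW[].
  have mB : measurable [set t | K < `|f (n j) t|] by exact: measurable_gt_level.
  rewrite addrC; apply: (small_int_split (D := [set t | K < `|f (n j) t|])) => //.
    move=> V mV VB.
    have := bandP j q qj; move=> /(_ V mV) h.
    apply: le_trans (h _) (hq q (leqnn q)).
    move=> t /VB[[[nH Dt] nW] /= Kt]; rewrite /band/= Kt/= leNgt.
    by apply/negP => Lt; apply: nH; split.
  move=> V mV VB.
  have -> : 2 * (e / 32) = (K + 1) * (2 * (e / (32 * (K + 1)))).
    by field; rewrite gt_eqF// ltr_wpDl.
  apply: vm_int_bounded_le => //; first by rewrite addr_ge0.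
    move=> t /VB[_ /negP]; rewrite -leNgt => /le_trans; apply.
    by rewrite lerDl.
  move=> V' mV' V'V; rewrite -(vm_int1 m mV'); apply/ltW/hd1 => //.
  apply: (le_eta V' mV' _).1 => t /V'V/VB[[] //].
- move=> i j ij; apply: aeW => t /=.
  have disj i' j' : (i' < j')%N -> ~ (H i' t /\ H j' t).
    by move=> ij' h; have := disjH _ _ ij'; rewrite -subset0 => /(_ t h).
  rewrite !indicE.
  have [Hi|nHi] := pselect (H i t); last by left; rewrite memNset// mulr0.
  have [Hj|nHj] := pselect (H j t); last by right; rewrite memNset// mulr0.
  by exfalso; have [/disj|/disj|eij] := ltngtP i j; [apply|apply|rewrite eij eqxx in ij].
Qed.

End assembly.

Theorem theorem4 (R : realType)
    (dS : measure_display) (S : measurableType dS)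
    (rho : {finite_measure set S -> \bar R})
    (X : completeNormedModType R) (B : bfs rho X)
    (dO : measure_display) (Omega : measurableType dO)
    (m : vector_measure Omega X) :
  ssp rho (bfs_fspace B) ->
  ssp rho (associate B) ->
  unif_ac rho (bfs_fspace B) [set B (m A) | A in measurable] ->
  forall x0 : banach_dual X, rybakov m x0 -> ssp (scalar_variation m x0) (L1 m).
Proof.
move=> sspX _ uac x0 ryb.
have ac (g : Omega -> R) (e : R) := vm_int_ac (m := m) (f := g) (e := e) sspX ryb.
split; first exact: L1_ac_norm.
move=> f intf [M fM].
have fM' n D : measurable D -> `|vm_int m (f n) D| <= M.
  move=> mD; apply: (vm_int_norm_le (intf n)) => // phi bphi.
  apply: (@le_trans _ _ (\int[scalar_variation m phi]_t `|f n t|%:E)%E).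
    have [mf _ _] := intf n; apply: ge0_subset_integral => //.
    by apply/measurable_EFinP; exact: measurableT_comp.
  by apply: le_trans (fM n); apply: ereal_sup_ubound; exists phi.
have [U [ultraU U_free]] := ultraFilterLemma eventually_filter.
have bands (q : nat) : exists k, forall l,
    U [set n | small_int m (f n) (band (f n) k l) q.+1%:R^-1].
  by apply: (uniform_bands sspX intf fM' ultraU uac); rewrite invr_gt0.
have [k kU] := choice bands.
have [n [L [dlt [n_incr bandP levelP dlt0 acP]]]] :=
  good_subsequence intf ac (uniform_level intf fM' x0) _ U_free kU.
exact: splitting_of_subsequence ac _ k n L dlt intf n_incr bandP levelP dlt0 acP.
Qed.
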